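(* For each integer $q\geq 1$, there exists no Gaussian random variable with positive variance in the $q$-th Wiener chaos $C_q=\{I_q(f): f\in L^2(\mu^q)\}$ associated with $\eta$.
   Context: Setting. $(\mathcal{Z},\mathscr{Z})$ is a measurable space with a $\sigma$-finite measure $\mu$. $\eta$ is a Poisson measure with control (intensity) $\mu$ on a probability space $(\Omega,\mathcal{F},\mathbb{P})$: a random $\sigma$-finite point measure with values in $\mathbb{N}_0\cup\{+\infty\}$ such that $\eta(B)$ is Poisson with mean $\mu(B)\in[0,+\infty]$ for $B\in\mathscr{Z}$ and $\eta(B_1),\dots,\eta(B_m)$ are independent for pairwise disjoint $B_1,\dots,B_m\in\mathscr{Z}$. Standing assumptions: $\eta$ is proper, i.e. a.s. $\eta=\sum_{n=1}^{\eta(\mathcal{Z})}\delta_{X_n}$ for a countable collection of random elements $X_n$ of $\mathcal{Z}$; and $\mathcal{F}=\sigma(\eta)$. For $\mu(B)<\infty$, $\hat\eta(B)=\eta(B)-\mu(B)$. Multiple integrals. $I_q:L^2(\mu^q)\to L^2(\mathbb{P})$ is the $q$-th order multiple Wiener-It\^o integral with respect to $\hat\eta$: the continuous linear map with $I_q(f)=I_q(\tilde f)$ ($\tilde f$ the symmetrization of $f$), $\mathbb{E}[I_p(f)I_q(g)]=\mathbf{1}_{\{p=q\}}\,q!\,\langle\tilde f,\tilde g\rangle_{L^2(\mu^q)}$, and, for bounded $f$ vanishing outside $B^q$ with $\mu(B)<\infty$, $I_q(f)=\sum_{J\subset\{1,\dots,q\}}(-1)^{q-|J|}\int\!\!\int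 f\,d\eta^{(|J|)}\,d\mu^{q-|J|}$, where the variables indexed by $J$ are integrated against the factorial measure $\eta^{(|J|)}$ (sum of Dirac masses at $(X_{n_1},\dots,X_{n_{|J|}})$ over tuples of pairwise distinct indices) and the others against $\mu$. *)

(* Defs.v *)
From HB Require Import structures.
From mathcomp Require Import all_boot all_order all_algebra perm.
From mathcomp Require Import all_classical all_reals all_analysis.
From mathcomp Require Import measurable_realfun.

Set Implicit Arguments.
Unset Strict Implicit.
Unset Printing Implicit Defensive.
Import Order.TTheory GRing.Theory Num.Theory.
Import numFieldNormedType.Exports.
Local Open Scope classical_set_scope.
Local Open Scope ring_scope.

Section power_measure.
Context d (T : measurableType d) (R : realType).
Local Open Scope ereal_scope.

Definition uncons_tuple n (t : n.+1.-tuple T) : T * n.-tuple T :=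
  (thead t, [tuple of behead t]).

Definition cons_pair n (p : T * n.-tuple T) : n.+1.-tuple T :=
  [the n.+1.-tuple T of p.1 :: p.2].

Lemma measurable_uncons_tuple n : measurable_fun setT (@uncons_tuple n).
Proof.
by apply/measurable_fun_pair; [exact: measurable_tnth|exact: measurable_behead].
Qed.

Lemma measurable_cons_pair n : measurable_fun setT (@cons_pair n).
Proof. exact: measurable_cons. Qed.

Lemma uncons_tupleK n : cancel (@uncons_tuple n) (@cons_pair n).
Proof. by move=> t; rewrite [RHS]tuple_eta; apply/val_inj. Qed.

Lemma cons_pairK n : cancel (@cons_pair n) (@uncons_tuple n).
Proof. by move=> [x t]; congr (_, _); apply/val_inj. Qed.

Section step.
Variables (mu : {sigma_finite_measure set T -> \bar R}) (n : nat).
Variable nu : {sigma_finite_measure set (n.-tuple T) -> \bar R}.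

Definition cons_measure : set (n.+1.-tuple T) -> \bar R :=
  pushforward (mu \x nu) (@cons_pair n).

Let cons_measure0 : cons_measure set0 = 0.
Proof. by rewrite /cons_measure /pushforward preimage_set0 measure0. Qed.

Let cons_measure_ge0 A : 0 <= cons_measure A.
Proof. rewrite /cons_measure /pushforward; exact: measure_ge0. Qed.

Let cons_measure_sigma_additive : semi_sigma_additive cons_measure.
Proof.
move=> F mF tF mUF; rewrite /cons_measure /pushforward preimage_bigcup.
apply: measure_semi_sigma_additive.
- by move=> k; rewrite -[X in measurable X]setTI; exact: measurable_cons_pair.
- apply/trivIsetP => i j _ _ ij; rewrite -preimage_setI.
  by move/trivIsetP : tF => /(_ _ _ _ _ ij) ->//; rewrite preimage_set0.
- rewrite -preimage_bigcup -[X in measurable X]setTI.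
  exact: measurable_cons_pair.
Qed.

HB.instance Definition _ := isMeasure.Build _ _ _ cons_measure
  cons_measure0 cons_measure_ge0 cons_measure_sigma_additive.

Let cons_measure_sigma_finite : sigma_finite setT cons_measure.
Proof.
have /sigma_finiteP[F [UF ndF Foo]] := sigma_finiteT mu.
have /sigma_finiteP[G [UG ndG Goo]] := sigma_finiteT nu.
exists (fun k => @uncons_tuple n @^-1` (F k `*` G k)).
  apply/seteqP; split=> // t _.
  have [i _ Fi] : (\bigcup_i F i) (thead t) by rewrite -UF.
  have [j _ Gj] : (\bigcup_i G i) [tuple of behead t] by rewrite -UG.
  exists (maxn i j) => //; split.
  - by move: Fi; exact/subsetPset/ndF/leq_maxl.
  - by move: Gj; exact/subsetPset/ndG/leq_maxr.
move=> k; have [mF Fk] := Foo k; have [mG Gk] := Goo k; split.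
  rewrite -[X in measurable X]setTI.
  by apply: measurable_uncons_tuple => //; exact: measurableX.
rewrite /cons_measure /pushforward -comp_preimage.
rewrite (_ : _ \o _ = id); last by apply/funext => p /=; exact: cons_pairK.
by rewrite product_measure1E// lte_mul_pinfty// ge0_fin_numE.
Qed.

HB.instance Definition _ :=
  @Measure_isSigmaFinite.Build _ _ _ cons_measure cons_measure_sigma_finite.

End step.

Fixpoint power_measure (mu : {sigma_finite_measure set T -> \bar R}) (n : nat) :
    {sigma_finite_measure set (n.-tuple T) -> \bar R} :=
  match n with
  | 0 => \d_([tuple] : 0.-tuple T)
  | n'.+1 => cons_measure mu (power_measure mu n')
  end.

End power_measure.

Section point_measure.
Context d (T : measurableType d) (R : realType) (I : choiceType).
Local Open Scope ereal_scope.
Variables (D : set I) (x : I -> T).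

Definition point_measure (A : set T) : \bar R := \esum_(i in D) \d_(x i) A.

Let point_measure0 : point_measure set0 = 0.
Proof. by rewrite /point_measure esum1// => i _; rewrite diracE in_set0. Qed.

Let point_measure_ge0 A : 0 <= point_measure A.
Proof. by apply: esum_ge0 => i _. Qed.

Let point_measure_sigma_additive : semi_sigma_additive point_measure.
Proof.
move=> F mF tF mUF.
suff -> : point_measure (\bigcup_k F k) = \sum_(0 <= k <oo) point_measure (F k).
  by apply: is_cvg_nneseries => k _ _; exact: point_measure_ge0.
rewrite nneseries_esumT; last by move=> k; exact: point_measure_ge0.
rewrite /point_measure (@esum_esum _ _ _ setT (fun=> D)) //.
pose e (p : I * nat) := (p.2, p.1).
rewrite (@reindex_esum _ _ _ (D `*`` (fun=> setT)) _ e); last first.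
  split=> [[i k] [] //|[i k] [j l] _ _ [-> ->]//|[k i] [_ Di]].
  by exists (i, k).
rewrite -(@esum_esum _ _ _ D (fun=> setT) (fun i k => \d_(x i) (F k)))//.
by apply: eq_esum => i _; rewrite -nneseries_esumT// -measure_semi_bigcup.
Qed.

HB.instance Definition _ := isMeasure.Build _ _ _ point_measure
  point_measure0 point_measure_ge0 point_measure_sigma_additive.

End point_measure.

Section poisson.
Context dZ dO (Z : measurableType dZ) (Omega : measurableType dO).
Context (R : realType).
Variables (mu : {sigma_finite_measure set Z -> \bar R}).
Variables (P : probability Omega R) (eta : R.-sigmafker Omega ~> Z).
Local Open Scope ereal_scope.

(* Poisson law on {0, 1, ..., +oo} with mean m in [0, +oo]; poisson_prob does
   not depend on its second argument. *)
Definition poisson_law (m : \bar R) (Y : Omega -> \bar R) : Prop :=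
  if m is r%:E then
    forall U : set nat,
      P (Y @^-1` [set k%:R%:E | k in U]) = poisson_prob r 0%N U
  else P (Y @^-1` [set +oo]) = 1.

Definition mutually_independent m (Y : 'I_m -> Omega -> \bar R) : Prop :=
  forall A : 'I_m -> set (\bar R), (forall i, measurable (A i)) ->
    P (\bigcap_i (Y i @^-1` A i)) = \prod_(i < m) P (Y i @^-1` A i).

Record poisson_measure : Prop := {
  poisson_point : forall w B, measurable B ->
    eta w B = +oo \/ exists k : nat, eta w B = k%:R%:E;
  poisson_mean : forall B, measurable B -> poisson_law (mu B) (eta ^~ B);
  poisson_indep : forall m (B : 'I_m -> set Z), (forall i, measurable (B i)) ->
    trivIset setT B -> mutually_independent (fun i => eta ^~ (B i)) }.

Definition generated_sigma_algebra : set (set Omega) :=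
  <<s \bigcup_(B in measurable)
        preimage_set_system setT (eta ^~ B) measurable >>.

Variable X : nat -> {RV P >-> Z}.

(* The atoms X n are indexed from 0, so their indices are the n < eta(Z). *)
Definition atom_index (w : Omega) : set nat :=
  [set n | n%:R%:E < eta w setT].

Definition proper_with : Prop :=
  {ae P, forall w B, measurable B ->
    eta w B = point_measure R (atom_index w) (X ^~ w) B}.

Definition factorial_measure (w : Omega) (k : nat) :
    {measure set (k.-tuple Z) -> \bar R} :=
  point_measure R
    [set s : k.-tuple nat | uniq s /\ forall i, atom_index w (tnth s i)]
    (fun s => [tuple X (tnth s i) w | i < k]).

End poisson.

Section multiple_integral.
Context dZ dO (Z : measurableType dZ) (Omega : measurableType dO).
Context (R : realType).
Variables (mu : {sigma_finite_measure set Z -> \bar R}).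
Variables (P : probability Omega R) (eta : R.-sigmafker Omega ~> Z).
Variable X : nat -> {RV P >-> Z}.

Definition symmetrization q (f : q.-tuple Z -> R) (z : q.-tuple Z) : R :=
  (q`!%:R)^-1 * \sum_(s : 'S_q) f [tuple tnth z (s i) | i < q].

(* The q-tuple with coordinates x along J and y along the complement of J, both
   taken in increasing order; the default value [point] is never reached. *)
Definition merge q (J : {set 'I_q}) (x : #|J|.-tuple Z)
    (y : #|~: J|.-tuple Z) : q.-tuple Z :=
  [tuple if i \in J then nth point x (index i (enum J))
         else nth point y (index i (enum (~: J))) | i < q].

Definition pathwise_integral q (f : q.-tuple Z -> R) (w : Omega) : R :=
  \sum_(J : {set 'I_q}) (-1) ^+ (q - #|J|) *
    \int[factorial_measure eta X w #|J|]_x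
      \int[power_measure mu #|~: J|]_y f (merge x y).

Local Notation L2 q := (Lfun (power_measure mu q) 2%:E).

(* These properties determine I q f up to P-null sets for f in L^2(mu^q); I acts
   on representatives, and its values outside L^2(mu^q) are unconstrained. *)
Record multiple_integrals (I : forall q, (q.-tuple Z -> R) -> Omega -> R) :
    Prop := {
  mi_Lfun : forall q (f : q.-tuple Z -> R), f \in L2 q ->
    I q f \in Lfun P 2%:E;
  mi_linear : forall q (a : R) (f g : q.-tuple Z -> R),
    f \in L2 q ->
    g \in L2 q ->
    I q (a *: f + g) = a *: I q f + I q g %[ae P];
  mi_continuous : forall q (f_ : nat -> q.-tuple Z -> R) (f : q.-tuple Z -> R),
    (forall n, f_ n \in L2 q) ->
    f \in L2 q ->
    ('N[power_measure mu q]_2%:E[EFin \o (f_ n \- f)%R])%E @[n --> \oo] --> 0%E ->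
    ('N[P]_2%:E[EFin \o (I q (f_ n) \- I q f)%R])%E @[n --> \oo] --> 0%E;
  mi_symmetrization : forall q (f : q.-tuple Z -> R), f \in L2 q ->
    I q f = I q (symmetrization f) %[ae P];
  mi_isometry : forall q (f g : q.-tuple Z -> R),
    f \in L2 q ->
    g \in L2 q ->
    ('E_P[I q f \* I q g] = q`!%:R%:E *
      \int[power_measure mu q]_z (symmetrization f z * symmetrization g z)%:E)%E;
  mi_orthogonal : forall p q (f : p.-tuple Z -> R) (g : q.-tuple Z -> R), p <> q ->
    f \in L2 p ->
    g \in L2 q ->
    ('E_P[I p f \* I q g] = 0)%E;
  mi_pathwise : forall q (f : q.-tuple Z -> R) (B : set Z),
    measurable_fun setT f ->
    (exists M : R, forall z, `|f z| <= M) ->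
    measurable B -> (mu B < +oo)%E ->
    (forall z, ~ (forall i, B (tnth z i)) -> f z = 0) ->
    I q f = pathwise_integral f %[ae P] }.

Definition wiener_chaos (I : forall q, (q.-tuple Z -> R) -> Omega -> R)
    (q : nat) : set {RV P >-> R} :=
  [set F : {RV P >-> R} | exists2 f : q.-tuple Z -> R, f \in L2 q &
    (F : Omega -> R) = I q f %[ae P]].

End multiple_integral.

(* The law N(m, s^2), the degenerate case s = 0 included; normal_prob m 0 is a
   uniform law. *)
Definition gaussian d (Omega : measurableType d) (R : realType)
    (P : probability Omega R) (F : {RV P >-> R}) : Prop :=
  exists m s : R, forall A : set R, measurable A ->
    distribution P F A = if s == 0 then \d_m A else normal_prob m s A.

(* Main.v *)
Require Import Defs.
From mathcomp Require Import all_boot all_order all_algebra perm.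
From mathcomp Require Import all_classical all_reals all_analysis.
From mathcomp Require Import measurable_realfun.
From mathcomp Require Import ring lra.
Import Order.TTheory GRing.Theory Num.Theory.
Local Open Scope classical_set_scope.
Local Open Scope ring_scope.
Set Implicit Arguments.
Unset Strict Implicit.
Unset Printing Implicit Defensive.

(** The tails of a Gaussian variable [F] are thin: [exp (l F^2)] is integrable
for some [l > 0].  In a chaos of order [q >= 1] this fails, because adding [k]
points to the configuration moves a non-zero element of the chaos by an amount
of order at least [k], whereas under the law of [eta] the presence of [k] extra
points in a set of finite measure costs only a factor [exp (O (k log k))], and
[k log k] is negligible against [k ^ 2].

To make this precise, fix a bounded measurable [h >= 0] supported in a set [B]
of finite measure, and put [m = \int h dmu > 0].  The variable
[E_k = \int h^{(x)k} d eta^(k)], divided by [m ^ k], is the density with respect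
to [P] of the law of [eta] augmented by [k] independent points of law
[h mu / m].  Everything needed about it follows from the properties of the
multiple integrals.
- The pathwise formula says [I_n (h^{(x)n}) = \sum_k 'C(n, k) (- m)^(n-k) E_k]
  almost surely; binomial inversion gives
  [E_k = \sum_n 'C(k, n) m^(k-n) I_n (h^{(x)n})], which is the definition of
  [tilt k] ([ae_tilt]).  In particular [E_k] is square integrable.
- Orthogonality and isometry then give (with [expectation_tilt])
  [E [I_q f E_k] = 'C(k, q) m^(k-q) E [I_q f I_q (h^{(x)q})]],
  [E [E_k] = m ^ k] and, for the number [N = I_1 (1_B) + mu B] of points in [B],
  [E [N E_k] = (mu B + k) m ^ k].
- Pointwise, [0 <= E_k <= (M N) ^ k], where [M] bounds [h], and [(M N) ^ k] is
  at most [exp (N + O (k^(3/2)))] ([pow_le_expR]).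
An elementary convexity inequality ([tilted_second_moment]) turns these facts
into [l E [I_q f E_k / m^k] ^ 2 <= E [N E_k / m^k] + O (k^(3/2)) + E [exp (l F^2)]]
for [F = I_q f].  If [E [I_q f I_q (h^{(x)q})] != 0], the left-hand side grows at
least like [k ^ 2] and the right-hand side only like [k ^ (3/2)]
([exp_square_not_integrable]).

It remains to find [h] with [E [I_q f I_q (h^{(x)q})] != 0] when [F] has positive
variance.  By isometry this expectation is [q! \int phi h^{(x)q} dmu^q], where
[phi] is the symmetrization of [f], and [phi] is square integrable and not
almost everywhere zero.  If all these integrals vanished, polarization
([ryser_permanent]) would give the vanishing of the integrals of [phi] over
rectangles, summed over all permutations of the coordinates; by a pi-lambda
argument the same holds for all measurable sets, and the symmetric sets
[phi > 0] and [phi < 0] would show that [phi = 0] almost everywhere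
([ae_eq0_of_tensor_power_orthogonal]). *)

(** * Tensor powers and rectangles *)

Definition tensor_power (R : realType) (T : Type) n (h : T -> R)
    (z : n.-tuple T) : R :=
  \prod_(i < n) h (tnth z i).

Section tensor_power.
Context d (T : measurableType d) (R : realType).
Implicit Types (h : T -> R).

Lemma measurable_tensor_power n h : measurable_fun setT h ->
  measurable_fun setT (@tensor_power R T n h).
Proof.
move=> mh; apply: measurable_prod => i _.
by apply: measurableT_comp => //; exact: measurable_tnth.
Qed.

Lemma tensor_power_ge0 n h (z : n.-tuple T) :
  (forall x, 0 <= h x) -> 0 <= tensor_power h z.
Proof. by move=> h0; apply: prodr_ge0. Qed.

Lemma tensor_power_cons n h (p : T * n.-tuple T) :
  tensor_power h (cons_pair p) = h p.1 * tensor_power h p.2.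
Proof.
rewrite /tensor_power big_ord_recl; congr (_ * _).
by apply: eq_bigr => i _; rewrite (tnth_nth p.1) /= -tnth_nth.
Qed.

Local Open Scope ereal_scope.
Variable mu : {sigma_finite_measure set T -> \bar R}.

Lemma integral_tensor_power n h (m : R) :
  measurable_fun setT h -> (forall x, 0 <= h x)%R ->
  \int[mu]_x (h x)%:E = m%:E ->
  \int[power_measure mu n]_z (tensor_power h z)%:E = (m ^+ n)%:E.
Proof.
move=> mh h0 hm; elim: n => [|n IH].
  rewrite /= integral_dirac //; last first.
    by apply/measurable_EFinP; exact: measurable_tensor_power.
  by rewrite diracT mul1e /tensor_power big_ord0.
rewrite /= /cons_measure ge0_integral_pushforward //=; last 3 first.
- exact: measurable_cons_pair.
- by apply/measurable_EFinP; exact: measurable_tensor_power.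
- by move=> z _; rewrite lee_fin tensor_power_ge0.
rewrite preimage_setT fubini_tonelli1 /fubini_F /=; last 2 first.
- apply/measurable_EFinP; apply: measurableT_comp.
    exact: measurable_tensor_power.
  exact: measurable_cons_pair.
- by move=> p; rewrite lee_fin tensor_power_ge0.
transitivity (\int[mu]_x ((h x)%:E * (m ^+ n)%:E)).
  apply: eq_integral => x _; rewrite -IH -ge0_integralZl//.
  - by apply: eq_integral => z _; rewrite -EFinM tensor_power_cons.
  - by apply/measurable_EFinP; exact: measurable_tensor_power.
  - by move=> z _; rewrite lee_fin tensor_power_ge0.
  - by rewrite lee_fin.
rewrite ge0_integralZr ?lee_fin//; last 3 first.
- by apply/measurable_EFinP.
- by move=> x _; rewrite lee_fin.
- by rewrite exprn_ge0// -lee_fin -hm integral_ge0// => x _; rewrite lee_fin.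
by rewrite hm -EFinM exprS.
Qed.

End tensor_power.

Definition rectangle (T : Type) q (A : 'I_q -> set T) : set (q.-tuple T) :=
  [set z | forall i, A i (tnth z i)].

Section rectangles.
Context d (T : measurableType d) (q : nat).

Definition rectangles : set (set (q.-tuple T)) :=
  [set rectangle A | A in [set A : 'I_q -> set T | forall i, measurable (A i)]].

Lemma measurable_rectangle (A : 'I_q -> set T) :
  (forall i, measurable (A i)) -> measurable (rectangle A).
Proof.
move=> mA; rewrite (_ : rectangle A =
    \bigcap_(i in [set: 'I_q]) ((fun z => tnth z i) @^-1` A i)).
  apply: fin_bigcap_measurable => // i _; rewrite -[X in measurable X]setTI.
  exact: measurable_tnth.
by apply/seteqP; split => z zB i; [move=> _|]; exact: zB.
Qed.

Lemma setI_closed_rectangles : setI_closed rectangles.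
Proof.
move=> _ _ [A mA <-] [B mB <-]; exists (fun i => A i `&` B i).
  by move=> i; exact: measurableI.
apply/seteqP; split=> z zAB; first by split=> i; case: (zAB i).
by move=> i; case: zAB => ? ?; split.
Qed.

Lemma rectanglesT : rectangles setT.
Proof. by exists (fun=> setT) => //; apply/seteqP. Qed.

Lemma measurable_tuple_rectangles : @measurable _ (q.-tuple T) = <<s rectangles >>.
Proof.
apply/seteqP; split; apply: smallest_sub.
- exact: smallest_sigma_algebra.
- apply: (big_ind (fun F => F `<=` <<s rectangles >>)) => //.
    by move=> F G FR GR A [/FR|/GR].
  move=> i _ _ [A mA <-]; apply: sub_sigma_algebra.
  exists (fun j => if j == i then A else setT); first by move=> j /=; case: ifP.
  apply/seteqP; split=> z /=.
    by move=> /(_ i); rewrite eqxx.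
  by move=> [_ zA] j; case: eqP => // ->.
- exact: sigma_algebra_measurable.
- by move=> _ [A mA <-]; exact: measurable_rectangle.
Qed.

End rectangles.

Definition box (T : Type) k (B : set T) : set (k.-tuple T) :=
  rectangle (fun _ : 'I_k => B).

Section box_facts.
Context d (T : measurableType d) (R : realType).

Lemma measurable_box k (B : set T) : measurable B -> measurable (@box T k B).
Proof. by move=> mB; exact: measurable_rectangle. Qed.

Lemma prod_indic_rectangle k (A : 'I_k -> set T) (z : k.-tuple T) :
  \prod_i \1_(A i) (tnth z i) = \1_(rectangle A) z :> R.
Proof.
rewrite [RHS]indicE; have [zA|] := boolP (z \in _).
  by rewrite big1// => i _; rewrite indicE mem_set//; move: zA; rewrite inE; apply.
rewrite notin_setE => /existsNP[i nA]; apply/eqP; rewrite prodf_seq_eq0.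
by apply/hasP; exists i; rewrite ?mem_index_enum //= /indic memNset//= eqxx.
Qed.

Lemma tensor_power_indic k (B : set T) (z : k.-tuple T) :
  tensor_power (\1_B : T -> R) z = \1_(box B) z.
Proof. exact: prod_indic_rectangle. Qed.

Lemma tensor_power_le k (B : set T) (h : T -> R) (M : R) (z : k.-tuple T) :
  (forall x, 0 <= h x <= M * \1_B x) ->
  tensor_power h z <= M ^+ k * \1_(box B) z.
Proof.
move=> hM; rewrite -tensor_power_indic /tensor_power.
have -> : M ^+ k = \prod_(i < k) M by rewrite prodr_const card_ord.
rewrite -big_split /=.
by apply: ler_prod => i _.
Qed.

Lemma integral_le_indic_fin_num (mu : {measure set T -> \bar R}) (B : set T)
    (h : T -> R) (M : R) :
  measurable B -> (mu B < +oo)%E -> 0 <= M -> measurable_fun setT h ->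
  (forall x, 0 <= h x <= M * \1_B x) ->
  (\int[mu]_x (h x)%:E)%E \is a fin_num.
Proof.
move=> mB muB M0 mh hM; have h0 x : 0 <= h x by case/andP: (hM x).
have mi : measurable_fun setT (EFin \o (\1_B : T -> R)).
  by apply/measurable_EFinP; exact: measurable_indic.
rewrite ge0_fin_numE; last by apply: integral_ge0 => x _; rewrite lee_fin.
apply: (@le_lt_trans _ _ (\int[mu]_x (M%:E * (\1_B x)%:E))%E).
  apply: ge0_le_integral => //.
  - by move=> x _; rewrite lee_fin.
  - exact/measurable_EFinP.
  - exact: emeasurable_funM.
  - by move=> x _; rewrite -EFinM lee_fin; case/andP: (hM x).
rewrite ge0_integralZl ?lee_fin// integral_indic// setIT.
by apply: lte_mul_pinfty => //; rewrite lee_fin.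
Qed.

End box_facts.

(** * Factorial measures of an almost surely finite configuration *)

Section point_measure_of_tuples.
Context d (T : measurableType d) (R : realType).
Variables (K : set nat) (x : nat -> T) (B : set T).
Local Open Scope ereal_scope.

(** The atoms of the [k]-th factorial measure that lie in the box [B ^ k] are
indexed by the injective [k]-tuples of indices of points in [B], whose number
is a falling factorial.  The same [N], the number of points in [B], serves for
all [k]. *)
Lemma point_measure_uniq_tuples : finite_set [set n | K n /\ B (x n)] ->
  exists N : nat, forall k,
   point_measure R [set s : k.-tuple nat | uniq s /\ forall i, K (tnth s i)]
     (fun s => [tuple x (tnth s i) | i < k]) (box B) = (N ^_ k)%:R%:E.
Proof.
move=> Kfin; set K' := [set n | _] in Kfin.
have [n0 n0P] : exists n0, forall n, K' n -> (n < n0)%N.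
  move: Kfin => /finite_fsetP[A AE].
  exists (\sum_(i <- finmap.enum_fset A) i).+1 => n Kn.
  rewrite ltnS; have nA : n \in finmap.enum_fset A by move: Kn; rewrite AE.
  by rewrite (big_rem n)//= leq_addr.
pose Kb : pred 'I_n0 := fun i => `[< K' i >].
exists #|Kb| => k.
rewrite /point_measure.
pose e (t : k.-tuple 'I_n0) : k.-tuple nat := map_tuple val t.
pose S := [set t : k.-tuple 'I_n0 | all Kb t && uniq t].
transitivity (\esum_(s in e @` S) (1 : \bar R)).
  rewrite [LHS]esum_mkcond [RHS]esum_mkcond; apply: eq_esum => s _.
  rewrite diracE.
  have -> : (s \in e @` S) =
      (s \in [set s0 : k.-tuple nat | uniq s0 /\ forall i, K (tnth s0 i)])
      && ([tuple x (tnth s i) | i < k] \in box B).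
    apply/idP/idP.
    - rewrite inE => -[t /= /andP[/allP tK ut] <-]; apply/andP; split.
        rewrite inE /=; split; first by rewrite map_inj_uniq//; exact: val_inj.
        by move=> i; rewrite tnth_map; have /asboolP[] := tK _ (mem_tnth i t).
      rewrite inE /= => i; rewrite tnth_mktuple tnth_map.
      by have /asboolP[] := tK _ (mem_tnth i t).
    - rewrite !inE /= => /andP[]; rewrite !inE /= => -[us sK] sB.
      have sK' i : K' (tnth s i).
        by split=> //; move: (sB i); rewrite tnth_mktuple.
      have sn i : (tnth s i < n0)%N by exact: n0P.
      exists [tuple Ordinal (sn i) | i < k].
        have H : e [tuple Ordinal (sn i) | i < k] = s.
          by apply: eq_from_tnth => i; rewrite tnth_map tnth_mktuple.
        apply/andP; split; last first.
          by rewrite -(map_inj_uniq val_inj) -[map _ _]/(val (e _)) H.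
        apply/all_tnthP => i; rewrite tnth_mktuple; apply/asboolP; exact: sK'.
      by apply: eq_from_tnth => i; rewrite tnth_map tnth_mktuple.
  by case: (s \in _) => //=; case: (_ \in _).
rewrite (@reindex_esum _ _ _ S _ e); last first.
  split; [by move=> t St; exists t| |by []].
  by move=> t u _ _ /(congr1 val) /= /(inj_map val_inj) ?; exact/val_inj.
rewrite esum_fset; last 2 first.
- exact: finite_finset.
- by [].
rewrite -(card_uniq_tuples k Kb).
rewrite /S -(@bigfs _ _ _ _ (index_enum _)
  (fun t : k.-tuple 'I_n0 => all Kb t && uniq t))//.
- rewrite sumEFin big_const iter_addr_0 cardsE; congr (_ %:R)%:E.
- exact: index_enum_uniq.
- by move=> t _; rewrite mem_index_enum.
Qed.

End point_measure_of_tuples.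

Section factorial_integral.
Context dZ dO (Z : measurableType dZ) (Omega : measurableType dO) (R : realType).
Variables (P : probability Omega R) (eta : R.-sigmafker Omega ~> Z).
Variable X : nat -> {RV P >-> Z}.

Definition factorial_integral (h : Z -> R) k w : R :=
  \int[factorial_measure eta X w k]_x tensor_power h x.

Variables (B : set Z) (mB : measurable B) (w : Omega).
Hypothesis fin_atoms : finite_set [set n | atom_index eta w n /\ B (X n w)].

(** On a configuration with finitely many points in [B], a tensor power of a
function supported in [B] is summed over finitely many tuples.  The case of the
indicator of [B], with [k = 1], identifies [N] as a factorial integral; this is
how [N] is later recognized as an element of the first two chaoses. *)
Lemma factorial_integral_bounds : exists N : nat,
  (forall k, factorial_integral (\1_B) k w = (N ^_ k)%:R) /\
  forall (h : Z -> R) (M : R), 0 <= M -> measurable_fun setT h ->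
   (forall x, 0 <= h x <= M * \1_B x) -> forall k,
   [/\ (factorial_measure eta X w k).-integrable setT
         (EFin \o @tensor_power R Z k h),
       0 <= factorial_integral h k w &
       factorial_integral h k w <= M ^+ k * (N ^_ k)%:R].
Proof.
have [N HN] := point_measure_uniq_tuples R fin_atoms.
have HN' k : factorial_measure eta X w k (box B) = (N ^_ k)%:R%:E.
  exact: HN.
have mbox k : measurable_fun setT (\1_(box B) : k.-tuple Z -> R).
  by apply: measurable_indic; exact: measurable_box.
exists N; split.
  move=> k; rewrite /factorial_integral /Rintegral.
  under eq_integral do rewrite tensor_power_indic.
  by rewrite integral_indic// ?setIT ?HN'//; exact: measurable_box.
move=> h M M0 mh hM k.
have h0 x : 0 <= h x by case/andP: (hM x).
have mtp : measurable_fun setT (@tensor_power R Z k h).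
  exact: measurable_tensor_power.
have le : (\int[factorial_measure eta X w k]_x (tensor_power h x)%:E <=
   (M ^+ k * (N ^_ k)%:R)%:E)%E.
  apply: (@le_trans _ _
      (\int[factorial_measure eta X w k]_x (M ^+ k * \1_(box B) x)%:E)%E).
    apply: ge0_le_integral => //.
    - by move=> z _; rewrite lee_fin tensor_power_ge0.
    - exact/measurable_EFinP.
    - by apply/measurable_EFinP; apply: measurable_funM => //; exact: mbox.
    - by move=> z _; rewrite lee_fin; exact: tensor_power_le.
  under eq_integral do rewrite EFinM.
  rewrite ge0_integralZl ?lee_fin ?exprn_ge0//; last first.
    by apply/measurable_EFinP; exact: mbox.
  by rewrite integral_indic// ?setIT ?HN' ?EFinM//; exact: measurable_box.
have ge : (0 <= \int[factorial_measure eta X w k]_x (tensor_power h x)%:E)%E.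
  by apply: integral_ge0 => z _; rewrite lee_fin tensor_power_ge0.
split; last 2 first.
- by apply: Rintegral_ge0 => z _; rewrite tensor_power_ge0.
- rewrite /factorial_integral /Rintegral -lee_fin fineK// ge0_fin_numE//.
  exact: (le_lt_trans le (ltry _)).
apply/integrableP; split; first exact/measurable_EFinP.
under eq_integral do rewrite /= ger0_norm ?tensor_power_ge0//.
exact: (le_lt_trans le (ltry _)).
Qed.

End factorial_integral.

(** * Inverting the pathwise formula *)

Section binomial_inversion.
Variable R : comNzRingType.

Lemma coef_XaddC_exp (a : R) n i :
  (('X + a%:P) ^+ n)`_i = 'C(n, i)%:R * a ^+ (n - i).
Proof.
rewrite addrC exprDn coef_sum; have [ni|ni] := ltnP n i.
  rewrite bin_small// mul0r big1// => j _; rewrite coefMn -polyC_exp coefCM coefXn.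
  by rewrite gtn_eqF ?mulr0 ?mul0rn// (leq_ltn_trans _ ni)// -ltnS.
rewrite (bigD1 (Ordinal (ni : (i < n.+1)%N)))//= big1 ?addr0.
  by rewrite coefMn -polyC_exp coefCM coefXn eqxx mulr1 mulr_natl.
move=> j /eqP jneq; rewrite coefMn -polyC_exp coefCM coefXn.
case: eqP => [ij|_]; last by rewrite mulr0 mul0rn.
by exfalso; apply: jneq; apply: val_inj.
Qed.

(** Umbral proof: for the linear functional [L] on polynomials that sends ['X^k]
to [u k], the hypothesis reads [v n = L (('X - a) ^+ n)], and the conclusion is
the image by [L] of the expansion of [(('X - a) + a) ^+ k]. *)
Lemma binomial_inversion (a : R) (u v : nat -> R) :
  (forall n, v n = \sum_(k < n.+1) 'C(n, k)%:R * (- a) ^+ (n - k) * u k) ->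
  forall k, u k = \sum_(n < k.+1) 'C(k, n)%:R * a ^+ (k - n) * v n.
Proof.
move=> uv k; pose L (p : {poly R}) := \sum_(i < k.+1) p`_i * u i.
have LE n : (n <= k)%N -> L (('X + (- a)%:P) ^+ n) = v n.
  move=> nk; rewrite uv /L.
  rewrite (big_ord_widen k.+1 (fun i => 'C(n, i)%:R * (- a) ^+ (n - i) * u i))//.
  rewrite [RHS]big_mkcond; apply: eq_bigr => i _; rewrite coef_XaddC_exp.
  by case: ifPn => //; rewrite -leqNgt => ni; rewrite bin_small// !mul0r.
have -> : u k = L 'X^k.
  rewrite /L (bigD1 ord_max)//= big1 ?addr0 ?coefXn ?eqxx ?mul1r// => i /eqP ik.
  rewrite coefXn; case: eqP => [ik'|_]; last by rewrite mul0r.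
  by exfalso; apply: ik; apply: val_inj.
have -> : 'X^k = \sum_(n < k.+1)
    ('C(k, n)%:R * a ^+ (k - n)) *: ('X + (- a)%:P) ^+ n :> {poly R}.
  have -> : 'X^k = (a%:P + ('X + (- a)%:P)) ^+ k :> {poly R}.
    by congr (_ ^+ _); rewrite addrCA -polyCD subrr addr0.
  rewrite exprDn; apply: eq_bigr => i _.
  by rewrite -polyC_exp mul_polyC -scaler_nat scalerA.
rewrite /L; under eq_bigr do rewrite coef_sum big_distrl.
rewrite exchange_big /=; apply: eq_bigr => n _; rewrite -LE; last by rewrite -ltnS.
by rewrite /L big_distrr; apply: eq_bigr => i _ /=; rewrite coefZ mulrA.
Qed.

End binomial_inversion.

Section pathwise.
Context dZ dO (Z : measurableType dZ) (Omega : measurableType dO) (R : realType).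
Variables (mu : {sigma_finite_measure set Z -> \bar R}).
Variables (P : probability Omega R) (eta : R.-sigmafker Omega ~> Z).
Variable X : nat -> {RV P >-> Z}.

Lemma tensor_power_merge (h : Z -> R) q (J : {set 'I_q}) x y :
  tensor_power h (@Defs.merge _ Z q J x y) = tensor_power h x * tensor_power h y.
Proof.
rewrite /tensor_power (bigID (mem J)) /=; congr (_ * _).
  rewrite (big_enum_val (A := mem J)
    (fun i => h (tnth (Defs.merge x y) i))) /=; apply: eq_bigr => j _.
  rewrite tnth_mktuple enum_valP (tnth_nth point); congr (h (nth _ _ _)).
  by rewrite /enum_val index_uniq ?enum_uniq// -cardE.
rewrite (eq_bigl (mem (~: J)%SET)); last by move=> i; rewrite /= inE.
rewrite (big_enum_val (A := mem (~: J)%SET)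
  (fun i => h (tnth (Defs.merge x y) i))) /=; apply: eq_bigr => j _.
have := enum_valP j; rewrite inE tnth_mktuple => /negbTE ->.
rewrite (tnth_nth point); congr (h (nth _ _ _)).
by rewrite /enum_val index_uniq ?enum_uniq// -cardE.
Qed.

Lemma pathwise_integral_tensor_power (h : Z -> R) (m : R) w n :
  measurable_fun setT h -> (forall x, 0 <= h x) ->
  (\int[mu]_x (h x)%:E = m%:E)%E ->
  (forall k, (factorial_measure eta X w k).-integrable setT
     (EFin \o @tensor_power R Z k h)) ->
  pathwise_integral mu eta X (@tensor_power R Z n h) w =
  \sum_(k < n.+1) 'C(n, k)%:R * (- m) ^+ (n - k) * factorial_integral eta X h k w.
Proof.
move=> mh h0 hm ih.
pose F k := (- m) ^+ (n - k) * factorial_integral eta X h k w.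
have cJn (J : {set 'I_n}) : (#|J| <= n)%N.
  by apply: leq_trans (max_card _) _; rewrite card_ord.
have JE (J : {set 'I_n}) : (-1) ^+ (n - #|J|) *
    \int[factorial_measure eta X w #|J|]_x
      \int[power_measure mu #|(~: J)%SET|]_y tensor_power h (Defs.merge x y)
    = F #|J|.
  rewrite /F [in RHS]exprNn -mulrA; congr (_ * _).
  have cJ : #|(~: J)%SET| = (n - #|J|)%N.
    by apply: (@addnI #|J|); rewrite cardsC card_ord subnKC.
  transitivity (\int[factorial_measure eta X w #|J|]_x
      (tensor_power h x * m ^+ (n - #|J|))).
    apply: eq_Rintegral => x _ /=; rewrite (@eq_Rintegral _ _ _ _ _
      (fun y => tensor_power h x * tensor_power h y)); last first.
      by move=> y _; exact: tensor_power_merge.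
    have mE := @integral_tensor_power _ _ _ mu #|(~: J)%SET| h m mh h0 hm.
    rewrite RintegralZl//.
      by rewrite /Rintegral mE cJ.
    apply/integrableP; split.
      by apply/measurable_EFinP; exact: measurable_tensor_power.
    under eq_integral do rewrite /= ger0_norm ?tensor_power_ge0//.
    by rewrite mE ltry.
  by rewrite RintegralZr// mulrC.
rewrite /pathwise_integral (eq_bigr _ (fun J _ => JE J)).
rewrite (partition_big (fun J : {set 'I_n} => inord #|J| : 'I_n.+1) xpredT)//=.
apply: eq_bigr => k _.
rewrite (eq_bigr (fun=> F k)); last first.
  by move=> J /eqP <-; rewrite inordK// ltnS.
rewrite sumr_const -mulrA mulr_natl; congr (_ *+ _).
have -> : 'C(n, k) = #|[set J : {set 'I_n} | #|J| == k]%SET|.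
  by rewrite card_draws card_ord.
apply: eq_card => J; rewrite [RHS]inE unfold_in /=; apply/eqP/eqP => [<-|Jk].
  by rewrite inordK// ltnS.
by rewrite Jk inord_val.
Qed.

Lemma factorial_integralE (h : Z -> R) (m : R) w :
  measurable_fun setT h -> (forall x, 0 <= h x) ->
  (\int[mu]_x (h x)%:E = m%:E)%E ->
  (forall k, (factorial_measure eta X w k).-integrable setT
     (EFin \o @tensor_power R Z k h)) ->
  forall k, factorial_integral eta X h k w =
    \sum_(n < k.+1) 'C(k, n)%:R * m ^+ (k - n) *
      pathwise_integral mu eta X (@tensor_power R Z n h) w.
Proof.
move=> mh h0 hm ih.
apply: (binomial_inversion (u := fun k => factorial_integral eta X h k w)
  (v := fun n => pathwise_integral mu eta X (@tensor_power R Z n h) w)) => n.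
exact: pathwise_integral_tensor_power.
Qed.

(** Properness turns the almost sure finiteness of the Poisson variable [eta B]
into the finiteness of the set of indices of points in [B]. *)
Lemma finite_atoms (B : set Z) : poisson_measure mu P eta -> proper_with eta X ->
  measurable B -> (mu B < +oo)%E ->
  {ae P, forall w, finite_set [set n | atom_index eta w n /\ B (X n w)]}.
Proof.
move=> etaP etaX mB muB.
pose A := [set w | eta w B < +oo]%E.
have mA : measurable A.
  rewrite -[A]setTI; apply: emeasurable_fun_infty_o => //.
  exact: measurable_kernel.
have PA : P A = 1%E.
  have := poisson_mean etaP mB.
  have /fineK <- : mu B \is a fin_num by rewrite ge0_fin_numE.
  move=> /(_ setT); rewrite probability_setT => <-; congr (P _).
  apply/seteqP; split => w /=.
    rewrite /A/= => etaB.
    case: (poisson_point etaP w mB) => [etaoo|[k ->]]; last by exists k.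
    by move: etaB; rewrite etaoo ltxx.
  by move=> [k _]; rewrite /A/= => <-; rewrite ltry.
have : {ae P, forall w, eta w B < +oo}%E.
  exists (~` A); split; [exact: measurableC| |by []].
  by rewrite probability_setC// PA subee.
move: etaX; apply: filterS2 => w etaX.
rewrite etaX// => etaB; apply: contrapT => infin.
move: etaB; rewrite ltNge => /negP; apply.
rewrite -(infinite_card_dirac R infin) /point_measure.
rewrite [leLHS]esum_mkcond [leRHS]esum_mkcond; apply: le_esum => n _.
case: ifPn => [|_]; last by case: ifPn.
rewrite inE => -[nK nB]; rewrite (mem_set nK) /dirac/= !indicE.
by rewrite !mem_set.
Qed.

End pathwise.

(** * Square integrable functions *)

Section square_integrable.
Context d (T : measurableType d) (R : realType) (mu : {measure set T -> \bar R}).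

Lemma Lfun2_of_sqr (f : T -> R) : measurable_fun setT f ->
  (\int[mu]_x (f x ^+ 2)%:E < +oo)%E -> f \in Lfun mu 2%:E.
Proof.
move=> mf if2; rewrite inE; apply/andP; split; rewrite inE//=.
rewrite /finite_norm unlock /=.
apply: poweR_lty; move: if2; congr (_ < _)%E.
by apply: eq_integral => x _ /=; rewrite powR_mulrn// real_normK// num_real.
Qed.

End square_integrable.

Section tensor_power_symmetric.
Context d (T : measurableType d) (R : realType).
Variable mu : {sigma_finite_measure set T -> \bar R}.

Lemma symmetrization_tensor_power (h : T -> R) q :
  symmetrization (@tensor_power R T q h) = @tensor_power R T q h.
Proof.
apply/funext => z; rewrite /symmetrization (eq_bigr (fun=> tensor_power h z)).
  by rewrite sumr_const card_Sn -[X in _ * X = _]mulr_natl mulrA mulVf ?mul1r//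
    pnatr_eq0 -lt0n fact_gt0.
move=> s _; rewrite /tensor_power [RHS](reindex_inj (@perm_inj _ s)) /=.
by apply: eq_bigr => i _; rewrite tnth_mktuple.
Qed.

Lemma tensor_power_Lfun2 (h : T -> R) (M : R) (B : set T) n :
  0 <= M -> measurable_fun setT h -> measurable B -> (mu B < +oo)%E ->
  (forall x, 0 <= h x <= M * \1_B x) ->
  @tensor_power R T n h \in Lfun (power_measure mu n) 2%:E.
Proof.
move=> M0 mh mB muB hM; apply: Lfun2_of_sqr; first exact: measurable_tensor_power.
have sqE z : tensor_power h z ^+ 2 = tensor_power (fun x => h x ^+ 2) z :> R.
  by rewrite /tensor_power -prodrXl.
under eq_integral do rewrite sqE.
have h2fin : (\int[mu]_x (h x ^+ 2)%:E)%E \is a fin_num.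
  apply: (integral_le_indic_fin_num (M := M ^+ 2) mB muB).
  - exact: sqr_ge0.
  - exact: measurable_funX.
  - move=> x; rewrite sqr_ge0/=; case/andP: (hM x) => hx0.
    rewrite indicE; case: (x \in B); rewrite ?mulr1 ?mulr0 => hx.
      by rewrite lerXn2r// nnegrE.
    by rewrite (@le_anti _ _ (h x) 0) ?hx0 ?hx// expr0n.
rewrite (integral_tensor_power n
  (m := fine (\int[mu]_x (h x ^+ 2)%:E)%E)) ?ltry//.
- exact: measurable_funX.
- by move=> x; rewrite sqr_ge0.
- by rewrite fineK.
Qed.

End tensor_power_symmetric.

Section expectation_linear_combination.
Context d (Omega : measurableType d) (R : realType) (P : probability Omega R).

Lemma Lfun_linear_combination (v : nat -> Omega -> R) (a : nat -> R) K :
  (forall n, v n \in Lfun P 2%:E) ->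
  (fun w => \sum_(n < K) a n * v n w) \in Lfun P 2%:E.
Proof.
move=> vL; rewrite (_ : (fun w => _) = \sum_(n < K) a n *: v n); last first.
  by apply/funext => w; rewrite fct_sumE.
have p1 : (1 <= 2%:E :> \bar R)%E by rewrite lee_fin ler1n.
by apply: rpred_sum => n _; apply: rpredZ; exact: vL.
Qed.

Lemma expectation_linear_combination (u : Omega -> R) (v : nat -> Omega -> R)
    (a e : nat -> R) K :
  u \in Lfun P 2%:E -> (forall n, v n \in Lfun P 2%:E) ->
  (forall n, 'E_P[u \* v n] = (e n)%:E)%E ->
  ('E_P[u \* (fun w => (\sum_(n < K) a n * v n w)%R)] =
    (\sum_(n < K) a n * e n)%:E)%E.
Proof.
move=> uL vL uv; elim: K => [|K IH].
  rewrite big_ord0 (_ : _ \* _ = cst 0) ?expectation_cst//.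
  by apply/funext => w /=; rewrite big_ord0 mulr0.
have uvL n : u \* v n \in Lfun P 1 by exact: Lfun2_mul_Lfun1.
rewrite (_ : _ \* _ = (u \* (fun w => \sum_(n < K) a n * v n w)) \+
    (a K \o* (u \* v K)))%R; last first.
  apply/funext => w /=.
  by rewrite big_ord_recr/= mulrDr mulrCA (mulrC (a K)) -mulrA.
rewrite expectationD ?IH ?expectationZl ?uv//.
- by rewrite big_ord_recr/= EFinD EFinM.
- by apply: Lfun2_mul_Lfun1 => //; exact: Lfun_linear_combination.
- by apply: Lfun_scale.
Qed.

End expectation_linear_combination.

(** * Exponential square moments against a tilted law *)

(** Since [y <= expR y], writing [k = u ^ 2] and
[x n = x * u * u * (n / k)] bounds each of the four factors by an exponential.
Taking [k] to be a square replaces a logarithm of [k] by the cruder [2 u]. *)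
Lemma pow_le_expR (R : realType) (x : R) (n u : nat) : 0 <= x -> (0 < u)%N ->
  (x * n%:R) ^+ (u ^ 2) <= expR (n%:R + (u ^ 2)%:R * (x + 2 * u%:R)).
Proof.
move=> x0 u0; set k := (u ^ 2)%N.
have k0 : (0 : R) < k%:R by rewrite ltr0n expn_gt0 u0.
have le_exp (y : R) : y <= expR y.
  by apply: le_trans (expR_ge1Dx _); rewrite lerDr.
have -> : n%:R + k%:R * (x + 2 * u%:R) =
    k%:R * (x + (u%:R + u%:R) + n%:R / k%:R) :> R.
  by field; rewrite gt_eqF.
rewrite expRM_natl; apply: lerXn2r; rewrite ?nnegrE ?mulr_ge0 ?expR_ge0//.
have -> : x * n%:R = x * (u%:R * u%:R) * (n%:R / k%:R) :> R.
  by rewrite -natrM mulnn -/k; field; rewrite gt_eqF.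
by rewrite !expRD !ler_pM ?le_exp ?mulr_ge0 ?divr_ge0 ?ler0n.
Qed.

Section tilted_inequality.
Context d (Omega : measurableType d) (R : realType) (P : probability Omega R).

(** Read [W] as a probability density.  Its entropy is at most [n + K] because
[ln W <= N + K], so this is the entropy inequality for [l Y ^ 2], followed by
the Cauchy-Schwarz inequality under the tilted law.  Both are proved pointwise
and without logarithms: with [L = N + K] one has
[(x - L) W <= exp x] for every [x], trivially when [x <= L], and otherwise
because [W <= exp L] and [x - L <= exp (x - L)]. *)
Lemma tilted_second_moment (Y W N : Omega -> R) (l K C y n : R) :
  0 < l -> Y \in Lfun P 2%:E -> W \in Lfun P 2%:E -> N \in Lfun P 2%:E ->
  (\int[P]_w (expR (l * Y w ^+ 2))%:E = C%:E)%E ->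
  {ae P, forall w, 0 <= W w <= expR (N w + K)} ->
  ('E_P[Y \* W] = y%:E)%E -> ('E_P[N \* W] = n%:E)%E -> ('E_P[W] = 1%:E)%E ->
  l * y ^+ 2 <= n + K + C.
Proof.
move=> l0 YL WL NL YC WK Ey En E1.
have WL1 : W \in Lfun P 1 by apply: Lfun_subset12 => //; exact: fin_num_measure.
(* The slope of the tangent a Y - a ^ 2 / (4 l) <= l Y ^ 2 that is optimal at the
   mean y of Y under the tilted law. *)
pose a := 2 * l * y.
pose H : Omega -> R :=
  (a \o* (Y \* W)) \- ((N \* W) \+ ((K + a ^+ 2 / (4 * l)) \o* W)).
have YW1 : Y \* W \in Lfun P 1 by exact: Lfun2_mul_Lfun1.
have NW1 : N \* W \in Lfun P 1 by exact: Lfun2_mul_Lfun1.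
have H1 : a \o* (Y \* W) \in Lfun P 1 by exact: Lfun_scale.
have H2 : (K + a ^+ 2 / (4 * l)) \o* W \in Lfun P 1 by exact: Lfun_scale.
have [_ add1] := @Lfun_addr_closed _ _ _ P 1%E (lexx _).
have H3 : (N \* W) \+ ((K + a ^+ 2 / (4 * l)) \o* W) \in Lfun P 1.
  exact: add1.
have HL : H \in Lfun P 1.
  by apply: add1 => //; exact: Lfun_oppr_closed.
have EH : ('E_P[H] = (a * y - (n + (K + a ^+ 2 / (4 * l))))%:E)%E.
  rewrite /H expectationB// expectationD// !expectationZl// Ey En E1.
  by rewrite mule1.
have Hint := (proj1 (Lfun1_integrable P H)) HL.
have YM : measurable_fun setT Y by move: YL => /sub_Lfun_mfun; rewrite inE.
have mH : measurable_fun setT H by move: HL => /sub_Lfun_mfun; rewrite inE.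
have EH_le : ('E_P[H] <= C%:E)%E.
  rewrite unlock -YC.
  (* The comparison H <= expR (l Y ^ 2) is almost sure only, and the almost sure
     monotonicity of integrals is for nonnegative functions. *)
  apply: (@le_trans _ _ (\int[P]_w ((EFin \o H)^\+ w))%E).
    apply: le_integral => //.
    - exact: integrable_funepos.
    - by move=> w _; rewrite funeposE le_max lexx.
  apply: ae_ge0_le_integral => //.
  - by apply: measurable_funepos; exact/measurable_EFinP.
  - apply/measurable_EFinP; apply: measurableT_comp => //.
    by apply: measurable_funM => //; exact: measurable_funX.
  - apply: filterS WK => w /andP[W0 WK] _.
    rewrite funeposE ge_max !lee_fin expR_ge0 andbT.
    set x := l * Y w ^+ 2; set L := N w + K in WK.
    have HE : H w <= (x - L) * W w.
      rewrite -subr_ge0.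
      rewrite [X in 0 <= X](_ : _ = (a / (2 * l) - Y w) ^+ 2 * l * W w); last first.
        by rewrite /H /x /L /=; field; rewrite gt_eqF.
      by rewrite mulr_ge0// mulr_ge0 ?sqr_ge0// ltW.
    apply: (le_trans HE); have [xL|xL] := leP x L.
      by apply: (@le_trans _ _ 0); rewrite ?expR_ge0// mulr_le0_ge0// subr_le0.
    apply: (@le_trans _ _ ((x - L) * expR L)).
      by rewrite ler_wpM2l// subr_ge0 ltW.
    have -> : expR x = expR (x - L) * expR L by rewrite -expRD subrK.
    rewrite ler_wpM2r ?expR_ge0//.
    by apply: le_trans (expR_ge1Dx _); rewrite lerDr.
move: EH_le; rewrite EH lee_fin -subr_ge0 => EH_le; rewrite -subr_ge0.
by move: EH_le; congr (0 <= _); rewrite /a; field; rewrite gt_eqF.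
Qed.

End tilted_inequality.

(** * Adding points to the configuration *)

Section chaos.
Context dZ dO (Z : measurableType dZ) (Omega : measurableType dO) (R : realType).
Variables (mu : {sigma_finite_measure set Z -> \bar R}).
Variables (P : probability Omega R) (eta : R.-sigmafker Omega ~> Z).
Variable X : nat -> {RV P >-> Z}.
Variable I : forall q : nat, (q.-tuple Z -> R) -> Omega -> R.
Hypothesis eta_poisson : poisson_measure mu P eta.
Hypothesis eta_proper : proper_with eta X.
Hypothesis I_multiple : multiple_integrals mu eta X I.

Variables (B : set Z) (b : R) (h : Z -> R) (M m : R).
Hypotheses (mB : measurable B) (muB : mu B = b%:E).
Hypotheses (mh : measurable_fun setT h) (hM : forall x, 0 <= h x <= M * \1_B x).
Hypotheses (M0 : 0 <= M) (hm : (\int[mu]_x (h x)%:E = m%:E)%E).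

Let h0 x : 0 <= h x. Proof. by case/andP: (hM x). Qed.
Let muBoo : (mu B < +oo)%E. Proof. by rewrite muB ltry. Qed.
Let indicM x : 0 <= (\1_B x : R) <= 1 * \1_B x.
Proof. by rewrite mul1r lexx andbT indicE. Qed.
Let int_indic : (\int[mu]_x (\1_B x)%:E = b%:E)%E.
Proof. by rewrite integral_indic// setIT. Qed.

Lemma mi_pathwise_tensor_power (g : Z -> R) (C : R) n :
  0 <= C -> measurable_fun setT g -> (forall x, 0 <= g x <= C * \1_B x) ->
  {ae P, forall w, I (@tensor_power R Z n g) w =
                   pathwise_integral mu eta X (@tensor_power R Z n g) w}.
Proof.
move=> C0 mg gC; have g0 x : 0 <= g x by case/andP: (gC x).
have tC (z : n.-tuple Z) : tensor_power g z <= C ^+ n * \1_(box B) z.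
  exact: tensor_power_le.
have bounded : exists C' : R, forall z : n.-tuple Z, `|tensor_power g z| <= C'.
  exists (C ^+ n) => z; rewrite ger0_norm ?tensor_power_ge0//.
  apply: le_trans (tC z) _; rewrite indicE; case: (_ \in _); rewrite ?mulr1 ?mulr0//.
  exact: exprn_ge0.
have supported (z : n.-tuple Z) :
    ~ (forall i, B (tnth z i)) -> tensor_power g z = 0.
  move=> zB; apply/eqP; rewrite eq_le tensor_power_ge0// andbT.
  by apply: le_trans (tC z) _; rewrite indicE memNset// mulr0.
have mt : measurable_fun setT (@tensor_power R Z n g).
  exact: measurable_tensor_power.
have := mi_pathwise I_multiple mt bounded mB muBoo supported.
by apply: filterS => w; apply.
Qed.

(** An almost sure version of the factorial integral [\int h^{(x)k} d eta^(k)],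
written in terms of multiple integrals so that it is a square integrable random
variable whose moments against any chaos are known.  Divided by [m ^ k], it is
the density of the law of [eta] with [k] independent points added. *)
Definition tilt k w : R :=
  \sum_(n < k.+1) 'C(k, n)%:R * m ^+ (k - n) * I (@tensor_power R Z n h) w.

Let tensor_L2 n : @tensor_power R Z n h \in Lfun (power_measure mu n) 2%:E.
Proof. exact: tensor_power_Lfun2 hM. Qed.

Lemma tilt_Lfun k : tilt k \in Lfun P 2%:E.
Proof.
apply: (Lfun_linear_combination (v := fun n => I (@tensor_power R Z n h))
  (fun n => 'C(k, n)%:R * m ^+ (k - n))).
by move=> n; exact: (mi_Lfun I_multiple).
Qed.

(** Orthogonality of the chaoses leaves only the term of order [q]. *)
Lemma expectation_tilt q (f : q.-tuple Z -> R) (e : R) k :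
  f \in Lfun (power_measure mu q) 2%:E ->
  ('E_P[I f \* I (@tensor_power R Z q h)] = e%:E)%E ->
  ('E_P[I f \* tilt k] = ('C(k, q)%:R * m ^+ (k - q) * e)%:E)%E.
Proof.
move=> fL fe.
rewrite (expectation_linear_combination
   (v := fun n => I (@tensor_power R Z n h))
   (fun n => 'C(k, n)%:R * m ^+ (k - n))
   (e := fun n => if n == q then e else 0)).
- congr EFin; have [kq|qk] := ltnP k q.
    rewrite bin_small// !mul0r big1// => i _; rewrite ltn_eqF ?mulr0//.
    by rewrite (leq_trans (ltn_ord i)).
  rewrite (bigD1 (Ordinal (qk : (q < k.+1)%N)))//= eqxx big1 ?addr0// => i /eqP iq.
  case: eqP => [iq'|_]; last by rewrite mulr0.
  by exfalso; apply: iq; exact: val_inj.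
- exact: (mi_Lfun I_multiple).
- by move=> n; exact: (mi_Lfun I_multiple).
- move=> n; case: eqP => [->//|/eqP nq].
  by apply: (mi_orthogonal I_multiple) => //; apply/eqP; rewrite eq_sym.
Qed.

Lemma expectation_tensor_power_indic n :
  ('E_P[I (@tensor_power R Z n \1_B) \* I (@tensor_power R Z n h)] =
    (n`!%:R * m ^+ n)%:E)%E.
Proof.
rewrite (mi_isometry I_multiple)//; last first.
  by apply: tensor_power_Lfun2 indicM => //; exact: measurable_indic.
rewrite !symmetrization_tensor_power EFinM -(integral_tensor_power n mh h0 hm).
congr (_ * _)%E; apply: eq_integral => z _; congr EFin.
rewrite /tensor_power -big_split/=; apply: eq_bigr => i _.
move: (hM (tnth z i)); rewrite indicE; case: (_ \in _); first by rewrite mul1r.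
by rewrite mulr0 mul0r => /le_anti <-.
Qed.

(** Comparison of the chaos expansion with the configuration: [N] is the number
of points in [B], and [tilt k] is a sum over the at most [N ^ k] injective
[k]-tuples of these points. *)
Lemma ae_tilt k : {ae P, forall w,
  I (@tensor_power R Z 0 \1_B) w = 1 /\
  exists N : nat, I (@tensor_power R Z 1 \1_B) w + b = N%:R /\
    0 <= tilt k w <= M ^+ k * N%:R ^+ k}.
Proof.
have H1 := finite_atoms eta_poisson eta_proper mB muBoo.
have H2 : {ae P, forall w, forall n, I (@tensor_power R Z n h) w =
    pathwise_integral mu eta X (@tensor_power R Z n h) w}.
  by apply: ae_foralln => n; exact: mi_pathwise_tensor_power hM.
have mi : measurable_fun setT (\1_B : Z -> R) by exact: measurable_indic.
have H3 : {ae P, forall w, forall n, I (@tensor_power R Z n \1_B) w =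
    pathwise_integral mu eta X (@tensor_power R Z n \1_B) w}.
  by apply: ae_foralln => n; exact: mi_pathwise_tensor_power indicM.
apply: filterS3 H1 H2 H3 => w H1 H2 H3.
have [N [HN1 HN2]] := factorial_integral_bounds mB H1.
have indic_int j : (factorial_measure eta X w j).-integrable setT
    (EFin \o @tensor_power R Z j \1_B).
  by have [] := HN2 _ _ ler01 mi indicM j.
have i0 x : 0 <= (\1_B x : R) by case/andP: (indicM x).
have HB n := pathwise_integral_tensor_power n mi i0 int_indic indic_int.
split.
  by rewrite H3 HB// big_ord1 HN1 /= bin0 expr0 !mulr1.
exists N; split.
  rewrite H3 HB// big_ord_recr big_ord1 /= !HN1 /= bin0 bin1 subnn subn0.
  by rewrite expr0 expr1 ffactn0 ffactn1; ring.
have [ih t0 tM] := HN2 _ _ M0 mh hM k.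
rewrite /tilt; under eq_bigr do rewrite H2.
rewrite -(factorial_integralE mh h0 hm); last first.
  by move=> j; have [] := HN2 _ _ M0 mh hM j.
rewrite t0 (le_trans tM)// ler_wpM2l ?exprn_ge0// -natrX ler_nat.
rewrite ffact_prod -[in leqRHS](card_ord k) -prod_nat_const.
by apply: leq_prod => i _; exact: leq_subr.
Qed.

Lemma expectation_tilt1 k : ('E_P[tilt k] = (m ^+ k)%:E)%E.
Proof.
have /expectation_tilt := expectation_tensor_power_indic 0.
have indic_L2 : @tensor_power R Z 0 \1_B \in Lfun (power_measure mu 0) 2%:E.
  by apply: tensor_power_Lfun2 indicM => //; exact: measurable_indic.
move=> /(_ k indic_L2); rewrite bin0 subn0 fact0 expr0 !mulr1 mul1r => <-.
rewrite unlock; apply: ae_eq_integral => //.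
- by apply/measurable_EFinP; have /sub_Lfun_mfun := tilt_Lfun k; rewrite inE.
- apply/measurable_EFinP; apply: measurable_funM.
    by have /sub_Lfun_mfun := mi_Lfun I_multiple indic_L2; rewrite inE.
  by have /sub_Lfun_mfun := tilt_Lfun k; rewrite inE.
- by apply: filterS (ae_tilt k) => w [I0 _] _ /=; rewrite I0 mul1r.
Qed.

(** Under the law with [k] points added, the mean number of points in [B] is
[mu B + k]. *)
Lemma expectation_count_tilt k : (0 < k)%N ->
  ('E_P[((I (@tensor_power R Z 1 \1_B) \+ cst b) \* tilt k)%R] =
    ((b + k%:R) * m ^+ k)%:E)%E.
Proof.
move=> k0.
have indic_L2 : @tensor_power R Z 1 \1_B \in Lfun (power_measure mu 1) 2%:E.
  by apply: tensor_power_Lfun2 indicM => //; exact: measurable_indic.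
have I1 := expectation_tilt k indic_L2 (expectation_tensor_power_indic 1).
have t1 : tilt k \in Lfun P 1.
  by apply: Lfun_subset12; [exact: fin_num_measure|exact: tilt_Lfun].
rewrite (_ : _ \* _ =
    (I (@tensor_power R Z 1 \1_B) \* tilt k) \+ (b \o* tilt k))%R; last first.
  by apply/funext => w /=; rewrite mulrDl (mulrC b).
rewrite expectationD; last 2 first.
- by apply: Lfun2_mul_Lfun1; [exact: (mi_Lfun I_multiple)|exact: tilt_Lfun].
- exact: Lfun_scale.
rewrite expectationZl// I1 expectation_tilt1 -EFinM -EFinD; congr EFin.
rewrite bin1 (_ : 1`! = 1%N)// mul1r expr1 mulrDl addrC; congr (_ + _).
by rewrite -mulrA -exprSr subn1 prednK.
Qed.

Hypothesis m0 : 0 < m.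

(** This is [tilted_second_moment] for the density [tilt k / m ^ k], with
[k = u ^ 2] and [N] the number of points in [B]. *)
Lemma tilt_growth_bound q (f : q.-tuple Z -> R) (e l C : R) u :
  f \in Lfun (power_measure mu q) 2%:E ->
  ('E_P[I f \* I (@tensor_power R Z q h)] = e%:E)%E ->
  0 < l -> (\int[P]_w (expR (l * I f w ^+ 2))%:E = C%:E)%E ->
  (0 < u)%N -> (q <= u ^ 2)%N ->
  l * ('C(u ^ 2, q)%:R * e / m ^+ q) ^+ 2 <=
    (b + (u ^ 2)%:R) + (u ^ 2)%:R * (M / m + 2 * u%:R) + C.
Proof.
move=> fL fe l0 lC u0; set k := (u ^ 2)%N => qk.
have k0 : (0 < k)%N by rewrite expn_gt0 u0.
have mk : m ^+ k != 0 by rewrite expf_neq0// gt_eqF.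
pose N := I (@tensor_power R Z 1 \1_B) \+ cst b.
have indic_L2 : @tensor_power R Z 1 \1_B \in Lfun (power_measure mu 1) 2%:E.
  by apply: tensor_power_Lfun2 indicM => //; exact: measurable_indic.
have NL : N \in Lfun P 2%:E.
  have p1 : (1 <= 2%:E :> \bar R)%E by rewrite lee_fin ler1n.
  have [_] := @Lfun_addr_closed _ _ _ P 2%:E p1; apply; last exact: Lfun_cst.
  exact: (mi_Lfun I_multiple).
have t1 : tilt k \in Lfun P 1.
  by apply: Lfun_subset12; [exact: fin_num_measure|exact: tilt_Lfun].
have scaleE (Y : Omega -> R) :
    Y \* ((m ^- k) \o* tilt k) = (m ^- k) \o* (Y \* tilt k).
  by apply/funext => w /=; rewrite mulrA.
have tL1 (Y : Omega -> R) : Y \in Lfun P 2%:E -> Y \* tilt k \in Lfun P 1.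
  by move=> YL; apply: Lfun2_mul_Lfun1 => //; exact: tilt_Lfun.
apply: (tilted_second_moment (Y := I f) (W := (m ^- k) \o* tilt k) (N := N)
  (K := k%:R * (M / m + 2 * u%:R)) (C := C)) => //.
- exact: (mi_Lfun I_multiple).
- by apply: Lfun_scale; [rewrite ler1n|exact: tilt_Lfun].
- exact: NL.
- exact: lC.
- apply: filterS (ae_tilt k) => w [_ [n [In /andP[t0 tn]]]] /=.
  have mk0 : 0 < m ^- k by rewrite invr_gt0 exprn_gt0.
  rewrite mulr_ge0//=; last exact: ltW.
  rewrite /N/= /cst In.
  apply: (@le_trans _ _ ((M / m * n%:R) ^+ k)).
    by rewrite !exprMn exprVn [leRHS]mulrAC ler_wpM2r//; exact: ltW.
  by apply: pow_le_expR => //; rewrite divr_ge0// ltW.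
- rewrite scaleE expectationZl ?tL1 ?(mi_Lfun I_multiple)//.
  rewrite (expectation_tilt k fL fe) -EFinM; congr EFin.
  rewrite mulrCA; rewrite (_ : m ^- k = m ^- (k - q) / m ^+ q).
    by field; rewrite ?expf_neq0 ?gt_eqF.
  by rewrite -[in LHS](subnK qk) exprD invfM.
- rewrite scaleE expectationZl ?tL1// expectation_count_tilt// -EFinM; congr EFin.
  by rewrite mulrC mulfK.
- by rewrite expectationZl// expectation_tilt1 -EFinM mulVf.
Qed.

End chaos.

(** * Exponential square moments of Gaussian variables *)

Section gaussian_exponential_moment.
Context (R : realType).
Local Notation leb := (@lebesgue_measure R).

(** [normal_pdf] agrees almost everywhere with the Radon-Nikodym derivative of
[normal_prob], for which the change of variables formula is available. *)
Lemma ge0_integral_normal_prob (a s : R) (g : R -> \bar R) :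
  measurable_fun setT g -> (forall x, (0 <= g x)%E) ->
  (\int[normal_prob a s]_x g x = \int[leb]_x (g x * (normal_pdf a s x)%:E))%E.
Proof.
move=> mg g0; have dom := @normal_prob_dominates R a s.
rewrite -(Radon_Nikodym_SigmaFinite.change_of_variables dom)//.
have fint := Radon_Nikodym_SigmaFinite.f_integrable dom.
have mpdf : measurable_fun setT (fun x => (normal_pdf a s x)%:E).
  by apply/measurable_EFinP; exact: measurable_normal_pdf.
apply: ae_eq_integral => //.
- by apply: emeasurable_funM => //; exact: measurable_int fint.
- exact: emeasurable_funM.
- apply: ae_eqe_mul2l; apply: integral_ae_eq => // A _ mA.
  by rewrite -(Radon_Nikodym_SigmaFinite.f_integral dom).
Qed.

Let measurable_expR_sqr (l : R) :
  measurable_fun setT (fun x : R => expR (l * x ^+ 2)).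
Proof. by apply: measurableT_comp => //; exact: measurable_funM. Qed.

(** With [l = 1 / (8 s^2)], the product of [exp (l x^2)] with the density of
variance [s^2] is at most a constant times the density of variance [2 s^2] with
the same mean: the difference of the exponents is a square. *)
Lemma normal_prob_exp_square (a s : R) : s != 0 ->
  exists2 l : R, 0 < l &
    (\int[normal_prob a s]_x (expR (l * x ^+ 2))%:E < +oo)%E.
Proof.
move=> s0; have s2 : 0 < s ^+ 2 by rewrite exprn_even_gt0.
exists (8 * s ^+ 2)^-1; first by rewrite invr_gt0 mulr_gt0.
set l := _^-1; pose t := Num.sqrt (2 * s ^+ 2).
have t0 : t != 0 by rewrite gt_eqF// sqrtr_gt0 mulr_gt0.
have t2 : t ^+ 2 = 2 * s ^+ 2 by rewrite sqr_sqrtr// mulr_ge0// ltW.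
have mexp : measurable_fun setT (fun x : R => expR (l * x ^+ 2)).
  exact: measurable_expR_sqr.
rewrite ge0_integral_normal_prob; last 2 first.
- exact/measurable_EFinP.
- by move=> x; rewrite lee_fin expR_ge0.
pose C := normal_peak s * expR (a ^+ 2 / (4 * s ^+ 2)) / normal_peak t.
have C0 : 0 <= C.
  rewrite !mulr_ge0 ?normal_peak_ge0 ?expR_ge0//.
  by rewrite invr_ge0 normal_peak_ge0.
apply: (@le_lt_trans _ _ (\int[leb]_x (C%:E * (normal_pdf a t x)%:E))%E); last first.
  rewrite integralZl//; last exact: integrable_normal_pdf.
  by rewrite integral_normal_pdf mule1 ltry.
apply: ge0_le_integral => //.
- by move=> x _; rewrite mule_ge0// lee_fin ?expR_ge0// normal_pdf_ge0.
- apply: emeasurable_funM; apply/measurable_EFinP => //.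
  exact: measurable_normal_pdf.
- apply: emeasurable_funM => //; apply/measurable_EFinP.
  exact: measurable_normal_pdf.
- move=> x _; rewrite -!EFinM lee_fin !normal_pdfE//= /C [in leRHS]mulrA.
  have p0 := normal_peak_gt0 t0; rewrite divfK ?gt_eqF//.
  rewrite mulrCA -mulrA ler_wpM2l ?normal_peak_ge0// /normal_fun.
  rewrite -!expRD ler_expR t2 -subr_ge0.
  rewrite (_ : _ - _ = (x - 2 * a) ^+ 2 / (8 * s ^+ 2)); last first.
    by rewrite /l; field.
  by rewrite divr_ge0 ?sqr_ge0// mulr_ge0// ltW.
Qed.

Lemma gaussian_exp_square d (Omega : measurableType d) (P : probability Omega R)
   (F : {RV P >-> R}) : gaussian F ->
  exists2 l : R, 0 < l & (\int[P]_w (expR (l * F w ^+ 2))%:E < +oo)%E.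
Proof.
move=> [a [s Fas]].
have mF : @measurable_fun _ _ Omega (measurableTypeR R) setT F.
  by move=> mT Y mY; exact: (@measurable_funPT _ _ _ _ F mT Y mY).
(* R and measurableTypeR R have the same measurable sets but different displays;
   G is F with the codomain on which normal_prob lives. *)
pose G : {mfun Omega >-> measurableTypeR R} :=
  @mfun_Sub _ _ Omega (measurableTypeR R) F (mem_set mF).
have lawE l : (\int[P]_w (expR (l * F w ^+ 2))%:E =
    \int[distribution P G]_x (expR (l * x ^+ 2))%:E)%E.
  rewrite ge0_integral_distribution//.
  by apply/measurable_EFinP; exact: measurable_expR_sqr.
have [s0|s0] := eqVneq s 0.
  exists 1 => //; rewrite lawE (@eq_measure_integral _ (measurableTypeR R) R setT
    (@dirac _ (measurableTypeR R) a R)); last first.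
    by move=> A mA _; have := Fas A mA; rewrite s0 eqxx.
  rewrite integral_dirac//; first by rewrite diracT mul1e ltry.
  by apply/measurable_EFinP; exact: measurable_expR_sqr.
have [l l0 lfin] := normal_prob_exp_square a s0.
exists l => //; rewrite lawE.
rewrite (@eq_measure_integral _ (measurableTypeR R) R setT (normal_prob a s))//.
by move=> A mA _; have := Fas A mA; rewrite (negbTE s0).
Qed.

End gaussian_exponential_moment.

(** * Tensor powers separate symmetric functions *)

Section ryser.
Variables (R : comNzRingType) (q : nat).

(** Ryser's formula for the permanent.  Expanding the products gives a sum over
all maps [t] of ['I_q] to itself, where [t] comes with the alternating sum of
the signs of the sets [S] that contain its image.  That sum is the expansion of
a product over [j] which vanishes unless [t] is onto. *)
Lemma ryser_permanent (x : 'I_q -> 'I_q -> R) :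
  \sum_(S : {set 'I_q}) (-1) ^+ #|(~: S)%SET| * \prod_i \sum_(j in S) x i j =
  \sum_(s : 'S_q) \prod_i x i (s i).
Proof.
pose c (t : {ffun 'I_q -> 'I_q}) (S : {set 'I_q}) : R :=
  \prod_j (if j \in S then 1 else if j \in codom t then 0 else -1).
have cE t S :
    c t S = if t \in ffun_on (mem S) then (-1) ^+ #|(~: S)%SET| else 0.
  rewrite /c; case: ifPn => [/ffun_onP tS|].
    rewrite (bigID (mem S)) /= big1 ?mul1r; last by move=> j ->.
    rewrite (eq_bigr (fun=> -1)); last first.
      move=> j /negbTE jS; rewrite jS ifN//; apply/negP => /codomP[i jE].
      by move: jS; rewrite jE; have := tS i => /= ->.
    by rewrite prodr_const; congr (_ ^+ _); apply: eq_card => j; rewrite !inE.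
  move=> /ffun_onP; rewrite -existsNP => -[i /negP tiS].
  by rewrite (bigD1 (t i))//= (negbTE tiS) codom_f mul0r.
transitivity (\sum_(t : {ffun 'I_q -> 'I_q}) (\sum_S c t S) * \prod_i x i (t i)).
  under [RHS]eq_bigr do rewrite big_distrl/=.
  rewrite exchange_big/=; apply: eq_bigr => S _.
  rewrite (bigA_distr_big (mem S)) big_distrr/= [LHS]big_mkcond/=.
  by apply: eq_bigr => t _; rewrite cE; case: ifP; rewrite ?mul0r.
have sumc t : \sum_S c t S = (injectiveb t)%:R.
  transitivity (\prod_j (1 + (if j \in codom t then 0 else -1) : R)).
    by rewrite bigA_distr.
  case: injectiveP => [/injF_onto tonto|tninj].
    by rewrite big1// => j _; rewrite tonto addr0.
  have : exists j, j \notin codom t.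
    apply: contrapT => /forallNP tonto; apply: tninj.
    have /image_injP tinj : #|fintype.image t 'I_q| == #|'I_q|.
      apply/eqP/eq_card => j; rewrite inE.
      by apply: contrapT => /negP; exact: tonto.
    by move=> i j; exact: tinj.
  by move=> [j jt]; rewrite (bigD1 j)//= (negbTE jt) subrr mul0r.
under eq_bigr do rewrite sumc mulr_natl mulrb.
rewrite -big_mkcond /= (reindex (@pval _)) /=; last first.
  by exists (insubd (1%g : 'S_q)) => t tinj; [apply: val_inj|]; exact: insubdK.
apply: eq_big => [s|s _]; first by rewrite (valP s).
by apply: eq_bigr => i _; rewrite pvalE.
Qed.

End ryser.

Section charge_uniqueness.
Context d (T : measurableType d) (R : realType).
Local Open Scope ereal_scope.

(** The measurable sets on which a charge vanishes form a lambda-system as soon as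
they include the whole space. *)
Lemma charge_eq0_pi_system (nu : {charge set T -> \bar R}) (G : set (set T)) :
  @measurable _ T = <<s G >> -> setI_closed G -> G setT ->
  (forall A, G A -> nu A = 0) -> forall A, measurable A -> nu A = 0.
Proof.
move=> GE GI GT G0 A; rewrite GE.
apply: (dynkin_induction (P := fun A => nu A = 0) GE) => //.
- exact: G0.
- move=> S mS S0; have := chargeU nu mS (measurableC mS) (setICr S).
  by rewrite setUv S0 add0e (G0 _ GT) => <-.
- move=> F mF tF F0.
  have := @charge_semi_sigma_additive _ _ _ nu F mF tF
    (bigcup_measurable (fun k _ => mF k)).
  rewrite (_ : (fun n => _) = cst 0); last by apply/funext => n; rewrite big1.
  by move=> /cvg_lim <-//; rewrite lim_cst.
Qed.

Lemma sum_pushforward_charge (nu : {charge set T -> \bar R}) (I : Type)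
    (r : seq I) (f : I -> {mfun T >-> T}) :
  exists rho : {charge set T -> \bar R},
    forall A, rho A = \sum_(i <- r) nu (f i @^-1` A).
Proof.
elim: r => [|i r [rho rhoE]]; first by exists czero => A; rewrite big_nil.
unshelve eexists (cadd (pushforward nu (f i)) rho).
  exact: measurable_funPT.
by move=> A; rewrite big_cons -rhoE.
Qed.

End charge_uniqueness.

Section permuted_tuple.
Context d (T : measurableType d) (R : realType) (q : nat).

Definition permute_tuple (s : 'S_q) (z : q.-tuple T) : q.-tuple T :=
  [tuple tnth z (s i) | i < q].

Lemma measurable_permute_tuple s : measurable_fun setT (permute_tuple s).
Proof.
apply/measurable_fun_tnthP => i; rewrite (_ : _ \o _ = fun z => tnth z (s i)).
  exact: measurable_tnth.
by apply/funext => z /=; rewrite tnth_mktuple.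
Qed.

Lemma symmetrization_permute (f : q.-tuple T -> R) s z :
  symmetrization f (permute_tuple s z) = symmetrization f z.
Proof.
rewrite /symmetrization; congr (_ * _); rewrite [RHS](reindex_inj (mulIg s)) /=.
apply: eq_bigr => t _; congr (f _); apply: eq_from_tnth => i.
by rewrite !tnth_mktuple permM.
Qed.

Lemma measurable_symmetrization (f : q.-tuple T -> R) :
  measurable_fun setT f -> measurable_fun setT (symmetrization f).
Proof.
move=> mf; apply: measurable_funM => //; apply: measurable_sum => s.
by apply: measurableT_comp => //; exact: measurable_permute_tuple.
Qed.

End permuted_tuple.

Section tensor_powers_separate.
Context d (T : measurableType d) (R : realType) (q : nat).
Variable mu : {sigma_finite_measure set T -> \bar R}.
Variable phi : q.-tuple T -> R.
Hypothesis mphi : measurable_fun setT phi.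
Hypothesis phi_sym : forall s z, phi (permute_tuple s z) = phi z.
Hypothesis phi_L2 : (\int[power_measure mu q]_z (phi z ^+ 2)%:E < +oo)%E.
Hypothesis phi_orth : forall (B : set T) (h : T -> R) (M : R),
  measurable B -> (mu B < +oo)%E -> 0 <= M -> measurable_fun setT h ->
  (forall x, 0 <= h x <= M * \1_B x) ->
  (\int[power_measure mu q]_z (phi z * tensor_power h z)%:E = 0)%E.

Section on_a_box.
Variables (B : set T) (mB : measurable B) (muB : (mu B < +oo)%E).

Let integrable_phi_tensor_power (h : T -> R) (M : R) :
  0 <= M -> measurable_fun setT h -> (forall x, 0 <= h x <= M * \1_B x) ->
  (power_measure mu q).-integrable setT
    (fun z => (phi z * tensor_power h z)%:E).
Proof.
move=> M0 mh hM; have hL := tensor_power_Lfun2 q M0 mh mB muB hM.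
by have /Lfun1_integrable := Lfun2_mul_Lfun1 (Lfun2_of_sqr mphi phi_L2) hL.
Qed.

Let psi z : \bar R := (phi z * \1_(box B) z)%:E.

Let psi_int : (power_measure mu q).-integrable setT psi.
Proof.
have -> : psi = fun z => (phi z * tensor_power \1_B z)%:E.
  by apply/funext => z; rewrite /psi tensor_power_indic.
apply: (@integrable_phi_tensor_power _ 1) => //.
by move=> x; rewrite mul1r lexx andbT indicE.
Qed.

(** Polarization: the hypothesis is applied to the sums [h S] of the indicators
of [A j `&` B] for [j] in [S], and the permanent that Ryser's formula produces
from their tensor powers is a sum of indicators of permuted rectangles. *)
Lemma sum_permuted_rectangles (A : 'I_q -> set T) :
  (forall i, measurable (A i)) ->
  (\sum_(s : 'S_q)
    \int[power_measure mu q]_(z in permute_tuple s @^-1` rectangle A) psi z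
   = 0)%E.
Proof.
move=> mA.
pose x (z : q.-tuple T) i j : R := \1_(A j `&` B) (tnth z i).
pose h (S : {set 'I_q}) (y : T) : R := \sum_(j in S) \1_(A j `&` B) y.
have mh S : measurable_fun setT (h S).
  rewrite (_ : h S =
      fun y => \sum_j if j \in S then \1_(A j `&` B) y else 0).
    apply: measurable_sum => j; case: (j \in S) => //.
    by apply: measurable_indic; exact: measurableI.
  by apply/funext => y; rewrite /h big_mkcond.
have hM S y : 0 <= h S y <= q%:R * \1_B y.
  rewrite sumr_ge0 //= mulr_natl -[X in _ *+ X](card_ord q) -sumr_const.
  rewrite /h big_mkcond; apply: ler_sum => j _; case: ifP => // _.
  by rewrite !indicE in_setI; case: (y \in B); rewrite ?andbF// ler_nat leq_b1.
have hE S z : tensor_power (h S) z = \prod_i \sum_(j in S) x z i j by [].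
have ih S := integrable_phi_tensor_power (ler0n R q) (mh S) (hM S).
transitivity (\int[power_measure mu q]_z (\sum_(S : {set 'I_q})
    ((-1) ^+ #|(~: S)%SET|)%:E * (phi z * tensor_power (h S) z)%:E))%E; last first.
  rewrite integral_sum//; last by move=> S; exact: integrableZl.
  rewrite big1// => S _; rewrite integralZl//.
  by rewrite (phi_orth mB muB (ler0n R q) (mh S) (hM S)) mule0.
have mperm s : measurable (permute_tuple s @^-1` rectangle A).
  rewrite -[X in measurable X]setTI; apply: measurable_permute_tuple => //.
  exact: measurable_rectangle.
under eq_bigr do rewrite integral_mkcond.
rewrite -integral_sum//; last first.
  by move=> s; apply/(integrable_mkcond _ (mperm s)); exact: integrableS psi_int.
apply: eq_integral => z _.
under [RHS]eq_bigr do rewrite -EFinM mulrCA.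
rewrite sumEFin -mulr_sumr; under [in RHS]eq_bigr do rewrite hE.
rewrite ryser_permanent (_ : \sum_(s : 'S_q) _ =
    \sum_(s : 'S_q) \prod_i x z i ((s^-1)%g i)); last first.
  rewrite [LHS](reindex (fun s : 'S_q => (s^-1)%g))//.
  by exists (fun s : 'S_q => (s^-1)%g) => s _; rewrite invgK.
rewrite mulr_sumr -sumEFin/=.
apply: eq_bigr => s _.
suff -> : \prod_i x z i ((s^-1)%g i) =
    \1_(rectangle A) (permute_tuple s z) * \1_(box B) z.
  rewrite /patch -[z \in _]/(permute_tuple s z \in rectangle A) indicE.
  by case: (_ \in _); rewrite ?mul1r// mul0r mulr0.
rewrite -tensor_power_indic -prod_indic_rectangle /tensor_power.
have -> : \prod_(i < q) (\1_B (tnth z i) : R) =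
    \prod_(i < q) \1_B (tnth z (s i)).
  by rewrite [LHS](reindex_inj (@perm_inj _ s)).
rewrite [LHS](reindex_inj (@perm_inj _ s)) -big_split/=.
apply: eq_bigr => i _; rewrite permK /x /permute_tuple tnth_mktuple.
by rewrite !indicE in_setI -natrM mulnb.
Qed.

(** The sum over all permutations of the images of the charge [psi mu^q] vanishes
on rectangles, hence everywhere; on a symmetric set it is [q!] times the
integral of [psi]. *)
Lemma integral_symmetric_set E : measurable E ->
  (forall s, permute_tuple s @^-1` E = E) ->
  (\int[power_measure mu q]_(z in E) psi z = 0)%E.
Proof.
move=> mE Esym.
pose f s : {mfun q.-tuple T >-> q.-tuple T} :=
  mfun_Sub (mem_set (@measurable_permute_tuple _ T q s)).
have [rho rhoE] :=
  sum_pushforward_charge (induced_charge psi_int) (index_enum 'S_q) f.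
have rho0 : rho E = 0%E.
  apply: (charge_eq0_pi_system (@measurable_tuple_rectangles _ T q)) => //.
  - exact: setI_closed_rectangles.
  - exact: rectanglesT.
  - by move=> _ [A mA <-]; rewrite rhoE; exact: sum_permuted_rectangles.
have Efin : (\int[power_measure mu q]_(z in E) psi z)%E \is a fin_num.
  by apply: integrable_fin_num => //; exact: integrableS psi_int.
move: rho0; rewrite rhoE (eq_bigr
  (fun=> (fine (\int[power_measure mu q]_(z in E) psi z))%:E)%E); last first.
  by move=> s _; rewrite fineK// -[X in _ = integral _ X _](Esym s).
rewrite sumEFin sumr_const card_Sn => /(congr1 fine)/= /eqP.
rewrite mulrn_eq0 -leqn0 leqNgt fact_gt0/= => /eqP E0.
by rewrite -(fineK Efin) E0.
Qed.

Lemma ae_eq0_on_box :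
  {ae power_measure mu q, forall z, box B z -> phi z = 0}.
Proof.
have mpsi := measurable_int _ psi_int.
have signed (E : set (q.-tuple T)) :
    measurable E -> (forall s, permute_tuple s @^-1` E = E) ->
    (forall z, E z -> 0 <= phi z) \/ (forall z, E z -> phi z <= 0) ->
    ae_eq (power_measure mu q) E psi (cst 0%E).
  move=> mE Es sgn; apply/(ae_eq_integral_abs (power_measure mu q) mE).
    exact: measurable_funTS.
  have psi0 := integral_symmetric_set mE Es.
  have i0 z : 0 <= (\1_(box B) z : R) by rewrite indicE.
  case: sgn => sgn.
    rewrite -[RHS]psi0; apply: eq_integral => z /[!inE] Ez.
    by rewrite gee0_abs// lee_fin mulr_ge0// sgn.
  transitivity (\int[power_measure mu q]_(z in E) ((-1)%:E * psi z))%E.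
    apply: eq_integral => z /[!inE] Ez; rewrite lee0_abs ?EFinN ?mulN1e//.
    by rewrite lee_fin mulr_le0_ge0// sgn.
  by rewrite integralZl ?psi0 ?mule0//; exact: integrableS psi_int.
have mEphi : measurable_fun setT (EFin \o phi) by exact/measurable_EFinP.
have mpos : measurable [set z | 0 < phi z].
  rewrite -[X in measurable X]setTI.
  exact: (emeasurable_fun_o_infty measurableT mEphi 0%E).
have mneg : measurable [set z | phi z < 0].
  rewrite -[X in measurable X]setTI.
  exact: (emeasurable_fun_infty_o measurableT mEphi 0%E).
have sym_pos s :
    permute_tuple s @^-1` [set z | 0 < phi z] = [set z | 0 < phi z].
  by apply/seteqP; split=> z /=; rewrite phi_sym.
have sym_neg s :
    permute_tuple s @^-1` [set z | phi z < 0] = [set z | phi z < 0].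
  by apply/seteqP; split=> z /=; rewrite phi_sym.
apply: filterS2 (signed _ mpos sym_pos (or_introl (fun z => @ltW _ _ _ _)))
  (signed _ mneg sym_neg (or_intror (fun z => @ltW _ _ _ _))).
move=> z posz negz zB; have [z0|z0|//] := ltgtP (phi z) 0.
- by have := negz z0; rewrite /psi indicE mem_set// mulr1 => -[].
- by have := posz z0; rewrite /psi indicE mem_set// mulr1 => -[].
Qed.

End on_a_box.

Lemma ae_eq0_of_tensor_power_orthogonal :
  {ae power_measure mu q, forall z, phi z = 0}.
Proof.
have /sigma_finiteP[F [UF ndF Foo]] := sigma_finiteT mu.
have : {ae power_measure mu q, forall z, forall n, box (F n) z -> phi z = 0}.
  by apply: ae_foralln => n; have [mF Fn] := Foo n; exact: ae_eq0_on_box.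
apply: filterS => z zF.
have Fz i : exists n, F n (tnth z i).
  by have : setT (tnth z i) by []; rewrite UF => -[n _ Fn]; exists n.
have [f fP] := choice Fz.
apply: (zF (\max_i f i)) => i /=; move: (fP i); apply/subsetPset/ndF.
exact: leq_bigmax.
Qed.

End tensor_powers_separate.

(** * No Gaussian variable in a chaos *)

Lemma quartic_beats_cubic (R : realType) (A D : R) (q : nat) : 0 < A ->
  exists u : nat, [/\ (0 < u)%N, (q <= u ^ 2)%N & D * u%:R ^+ 3 < A * u%:R ^+ 4].
Proof.
move=> A0; pose u := (maxn q (Num.truncn (D / A)).+1).
have u0 : (0 < u)%N by rewrite leq_max orbT.
exists u; split=> //.
  by rewrite (leq_trans (leq_maxl q (Num.truncn (D / A)).+1))// leq_pmulr.
have ur : 0 < u%:R :> R by rewrite ltr0n.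
have DAu : D < A * u%:R.
  rewrite mulrC -ltr_pdivrMr//; apply: lt_le_trans (truncnS_gt _) _.
  by rewrite ler_nat leq_maxr.
by rewrite (exprS _ 3) (mulrA A) ltr_pM2r// exprn_gt0.
Qed.

Section no_gaussian.
Context (R : realType) (dZ dO : measure_display)
  (Z : measurableType dZ) (Omega : measurableType dO)
  (mu : {sigma_finite_measure set Z -> \bar R}) (P : probability Omega R)
  (eta : R.-sigmafker Omega ~> Z) (X : nat -> {RV P >-> Z})
  (I : forall q : nat, (q.-tuple Z -> R) -> Omega -> R)
  (eta_poisson : poisson_measure mu P eta)
  (eta_proper : proper_with eta X)
  (I_multiple : multiple_integrals mu eta X I).

(** With [k = u ^ 2] points added, the mean of [I f] is ['C(k, q) e / m^q], which
is at least [k] times a non-zero constant in absolute value because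
['C(k, q) q! >= k]; so [tilt_growth_bound] bounds a multiple of [u ^ 4] by a
multiple of [u ^ 3]. *)
Lemma exp_square_not_integrable (B : set Z) (h : Z -> R) (M e l : R) q
    (f : q.-tuple Z -> R) : (0 < q)%N ->
  measurable B -> (mu B < +oo)%E -> 0 <= M -> measurable_fun setT h ->
  (forall x, 0 <= h x <= M * \1_B x) ->
  f \in Lfun (power_measure mu q) 2%:E ->
  ('E_P[I f \* I (@tensor_power R Z q h)] = e%:E)%E -> e != 0 ->
  0 < l -> (\int[P]_w (expR (l * I f w ^+ 2))%:E = +oo)%E.
Proof.
move=> q0 mB muB M0 mh hM fL fe e0 l0.
apply/eqP; rewrite eq_le leey /= leNgt; apply/negP => lC.
have h0 x : 0 <= h x by case/andP: (hM x).
have gL : @tensor_power R Z q h \in Lfun (power_measure mu q) 2%:E.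
  exact: tensor_power_Lfun2 hM.
have hfin : (\int[mu]_x (h x)%:E)%E \is a fin_num.
  exact: integral_le_indic_fin_num mB muB M0 mh hM.
pose m := fine (\int[mu]_x (h x)%:E)%E.
have hm : (\int[mu]_x (h x)%:E = m%:E)%E by rewrite fineK.
have m0 : 0 < m.
  rewrite lt_neqAle -lee_fin -hm integral_ge0 ?andbT => [|x _]; last first.
    by rewrite lee_fin.
  (* If m = 0 then the q-th tensor power of h is zero almost everywhere. *)
  apply/eqP => m0; move: e0; apply/negP/negPn/eqP.
  have gE := integral_tensor_power q mh h0 hm.
  have g0 : ae_eq (power_measure mu q) setT
      (fun z => (tensor_power h z)%:E) (cst 0%E).
    apply/ae_eq_integral_abs => //.
      by apply/measurable_EFinP; exact: measurable_tensor_power.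
    under eq_integral do rewrite gee0_abs ?lee_fin ?tensor_power_ge0//.
    by rewrite gE -m0 expr0n eqn0Ngt q0.
  apply: EFin_inj; rewrite -fe (mi_isometry I_multiple)//.
  rewrite symmetrization_tensor_power (ae_eq_integral (cst 0%E))//.
  - by rewrite integral_cst// mul0e mule0.
  - apply/measurable_EFinP; apply: measurable_funM; last first.
      exact: measurable_tensor_power.
    by apply: measurable_symmetrization; have /sub_Lfun_mfun := fL; rewrite inE.
  - by apply: filterS g0 => z /(_ Logic.I) g0 _; rewrite EFinM g0 mule0.
pose b := fine (mu B).
have muBE : mu B = b%:E by rewrite fineK// ge0_fin_numE.
have lCfin : (\int[P]_w (expR (l * I f w ^+ 2))%:E)%E \is a fin_num.
  by rewrite ge0_fin_numE// integral_ge0// => w _; rewrite lee_fin expR_ge0.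
pose C := fine (\int[P]_w (expR (l * I f w ^+ 2))%:E)%E.
have C0 : 0 <= C.
  by rewrite fine_ge0// integral_ge0// => w _; rewrite lee_fin expR_ge0.
have b0 : 0 <= b by rewrite fine_ge0.
pose A := l * (e / (q`!%:R * m ^+ q)) ^+ 2.
have A0 : 0 < A.
  have qf0 : q`!%:R != 0 :> R by rewrite pnatr_eq0 -lt0n fact_gt0.
  have mq0 : m ^+ q != 0 by rewrite expf_neq0// gt_eqF.
  by rewrite mulr_gt0// exprn_even_gt0//= mulf_neq0// invr_neq0// mulf_neq0.
(* The coefficients of the bound of tilt_growth_bound, where every power of u is
   at most u ^ 3. *)
have [u [u0 qu]] := quartic_beats_cubic (b + 1 + M / m + 2 + C) q A0.
have := tilt_growth_bound eta_poisson eta_proper I_multiple mB muBE mh hM M0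
  hm m0 fL fe l0 (esym (fineK lCfin)) u0 qu.
rewrite -/C; set k := (u ^ 2)%N => bound; rewrite ltNge => /negP; apply.
have u1 : 1 <= u%:R :> R by rewrite ler1n.
have kE : k%:R = u%:R ^+ 2 :> R by rewrite -natrX.
apply: (@le_trans _ _ (l * ('C(k, q)%:R * e / m ^+ q) ^+ 2)).
  have kC : (k <= 'C(k, q) * q`!)%N.
    rewrite bin_ffact; move: q0 qu; rewrite -/k; case: (q) => // q' _ qk.
    by rewrite ffactnS leq_pmulr// ffact_gt0 -ltnS prednK// (leq_ltn_trans _ qk).
  have qf : 0 < q`!%:R :> R by rewrite ltr0n fact_gt0.
  have {}kC : k%:R / q`!%:R <= 'C(k, q)%:R :> R.
    by rewrite ler_pdivrMr// -natrM ler_nat.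
  rewrite /A (_ : l * _ * _ = l * (k%:R / q`!%:R * (e / m ^+ q)) ^+ 2); last first.
    by rewrite kE; field; rewrite expf_neq0 ?gt_eqF.
  rewrite -[X in _ <= l * X ^+ 2]mulrA ler_wpM2l ?(ltW l0)//.
  rewrite [leLHS]exprMn [leRHS]exprMn ler_wpM2r ?sqr_ge0//.
  by apply: lerXn2r => //; rewrite nnegrE ?divr_ge0 ?ler0n.
apply: (le_trans bound); rewrite kE.
have Mm : 0 <= M / m by rewrite divr_ge0// ltW.
have u3 : 1 <= u%:R ^+ 3 :> R by rewrite exprn_ege1.
have u23 : u%:R ^+ 2 <= u%:R ^+ 3 :> R by rewrite ler_weXn2l.
have := ler_wpM2l Mm u23; have := ler_wpM2l b0 u3; have := ler_wpM2l C0 u3.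
lra.
Qed.

End no_gaussian.

Theorem proposition1p6 (R : realType) (dZ dO : measure_display)
  (Z : measurableType dZ) (Omega : measurableType dO)
  (mu : {sigma_finite_measure set Z -> \bar R}) (P : probability Omega R)
  (eta : R.-sigmafker Omega ~> Z) (X : nat -> {RV P >-> Z})
  (I : forall q : nat, (q.-tuple Z -> R) -> Omega -> R)
  (eta_poisson : poisson_measure mu P eta)
  (eta_proper : proper_with eta X)
  (F_sigma_eta : @measurable dO Omega = generated_sigma_algebra eta)
  (I_multiple : multiple_integrals mu eta X I)
  (q : nat) (q_ge1 : (1 <= q)%N) :
  ~ exists F : {RV P >-> R},
      [/\ wiener_chaos mu I q F, gaussian F & (0 < 'V_P[F])%E].
Proof.
move=> [F [[f fL FI] gF VF]].
have mf : measurable_fun setT f by have /sub_Lfun_mfun := fL; rewrite inE.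
have IfL := mi_Lfun I_multiple fL.
have mIf : measurable_fun setT (I q f) by have /sub_Lfun_mfun := IfL; rewrite inE.
have mexp l (Y : Omega -> R) : measurable_fun setT Y ->
    measurable_fun setT (fun w => (expR (l * Y w ^+ 2))%:E).
  move=> mY; apply/measurable_EFinP; apply: measurableT_comp => //.
  by apply: measurable_funM => //; exact: measurable_funX.
have [l l0 lF] := gaussian_exp_square gF.
have lIf : (\int[P]_w (expR (l * I q f w ^+ 2))%:E < +oo)%E.
  rewrite (ae_eq_integral (fun w => (expR (l * F w ^+ 2))%:E))//.
  - exact: mexp.
  - exact: mexp.
  - by apply: filterS FI => w /(_ Logic.I) ->.
pose phi := symmetrization f.
have isom (g : q.-tuple Z -> R) :
    g \in Lfun (power_measure mu q) 2%:E -> symmetrization g = g ->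
    ('E_P[I q f \* I q g] =
      q`!%:R%:E * \int[power_measure mu q]_z (phi z * g z)%:E)%E.
  by move=> gL gs; rewrite (mi_isometry I_multiple)// gs.
have qf0 : (0 < q`!%:R%:E :> \bar R)%E by rewrite lte_fin ltr0n fact_gt0.
have IfIf : 'E_P[I q f \* I q f]%E \is a fin_num.
  by apply: expectation_fin_num; exact: Lfun2_mul_Lfun1.
have isomff := mi_isometry I_multiple fL fL.
(* q! times this integral is the second moment of I f. *)
have phi_L2 : (\int[power_measure mu q]_z (phi z ^+ 2)%:E < +oo)%E.
  rewrite ltey; apply/eqP => phioo; move: IfIf; rewrite isomff.
  by rewrite (_ : integral _ _ _ = +oo%E) ?gt0_muley.
have phi0 : {ae power_measure mu q, forall z, phi z = 0}.
  apply: ae_eq0_of_tensor_power_orthogonal => //.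
  - exact: measurable_symmetrization.
  - by move=> s z; exact: symmetrization_permute.
  - move=> B h M mB muB M0 mh hM.
    have gL := tensor_power_Lfun2 q M0 mh mB muB hM.
    have gE := isom _ gL (symmetrization_tensor_power h q).
    have Efin : 'E_P[I q f \* I q (@tensor_power R Z q h)]%E \is a fin_num.
      apply: expectation_fin_num; apply: Lfun2_mul_Lfun1 => //.
      exact: (mi_Lfun I_multiple).
    have [e0|e0] :=
        eqVneq (fine 'E_P[I q f \* I q (@tensor_power R Z q h)]%E) 0.
      move: gE; rewrite -(fineK Efin) e0 => /esym/eqP.
      by rewrite mule_eq0 gt_eqF//= => /eqP.
    by move: lIf; rewrite (exp_square_not_integrable eta_poisson eta_proper
      I_multiple q_ge1 mB muB M0 mh hM fL (esym (fineK Efin)) e0 l0) ltxx.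
have EIf : ('E_P[I q f \* I q f] = 0)%E.
  rewrite isomff (ae_eq_integral (cst 0%E))//.
  - by rewrite integral_cst// mul0e mule0.
  - apply/measurable_EFinP; apply: measurable_funM;
      exact: measurable_symmetrization.
  - by apply: filterS phi0 => z phiz _; rewrite -/phi phiz mul0r.
have EF : (\int[P]_w (F w ^+ 2)%:E = 0)%E.
  rewrite -[RHS]EIf unlock; apply: ae_eq_integral => //.
  - by apply/measurable_EFinP; exact: measurable_funX.
  - by apply/measurable_EFinP; exact: measurable_funM.
  - by apply: filterS FI => w /(_ Logic.I) -> _ /=; rewrite expr2.
have FL : (F : Omega -> R) \in Lfun P 2%:E.
  by apply: Lfun2_of_sqr => //; rewrite EF.
move: VF; rewrite varianceE// (_ : 'E_P[_]%E = 0%E); last first.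
  by rewrite unlock -[RHS]EF.
rewrite sub0e oppe_gt0 ltNge => /negP; apply; exact: sqre_ge0.
Qed.
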